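(* Let $n\ge 3$, let $c\in\mathbb{R}$, and let $M^n$ be an $n$-dimensional connected hypersurface immersed in a real space form $\mathbb{Q}_c^{n+1}$ of constant sectional curvature $c$, with constant Ricci eigenvalues. Then $M^n$ is isoparametric if and only if the mean curvature $H$ of $M^n$ is constant.
   Context: $\mathbb{Q}_c^{n+1}$ denotes the simply connected real space form of dimension $n+1$ and constant sectional curvature $c$. Everything is smooth; $M^n$ is given by an immersion into $\mathbb{Q}_c^{n+1}$ and carries the induced metric $g$. A unit normal vector field $\nu$ along $M$ is fixed, $A$ is the shape operator with respect to $\nu$, its eigenvalues $\lambda_1,\dots,\lambda_n$ at a point (with multiplicity) are the principal curvatures, and $H=\frac1n\mathrm{tr}(A)$ is the mean curvature. The hypersurface is called isoparametric if all its principal curvatures are constant on $M$. The Ricci eigenvalues of $M$ at $p$ are the eigenvalues of the self-adjoint Ricci operator $\widehat{\mathrm{Ric}}_p\colon T_pM\to T_pM$ defined by $g(\widehat{\mathrm{Ric}}(X),Y)=\mathrm{Ric}(X,Y)$. $M$ has constant Ricci eigenvalues if these eigenvalues, counted with multiplicity, do not depend on the point $p\in M$. *)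

(* Defs.v *)
From HB Require Import structures.
From mathcomp Require Import all_boot all_order all_algebra.
From mathcomp Require Import all_classical all_reals all_analysis.

Set Implicit Arguments.
Unset Strict Implicit.
Unset Printing Implicit Defensive.

Import Order.TTheory GRing.Theory Num.Theory.
Import numFieldNormedType.Exports.

Local Open Scope classical_set_scope.
Local Open Scope ring_scope.

(* Vectors are rows and matrices act on the right: row i of ['J F x] is the
   i-th partial derivative of [F], and the matrix of an endomorphism [L] of a
   tangent space, in a coordinate basis, has the coordinates of [L e_i] as its
   i-th row. *)

Section EuclideanCalculus.
Context {R : realType}.

Definition pd m (i : 'I_m) (f : 'rV[R]_m -> R) (x : 'rV[R]_m) : R :=
  'D_(delta_mx 0 i : 'rV[R]_m) f x.

(* Membership in C^k(U), for [U] open. *)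
Fixpoint Ck m (k : nat) (U : set 'rV[R]_m) (f : 'rV[R]_m -> R) : Prop :=
  if k is k'.+1
  then (forall x, U x -> differentiable f x) /\
       (forall i : 'I_m, Ck k' U (pd i f))
  else forall x, U x -> {for x, continuous f}.

Definition smooth_fun m (U : set 'rV[R]_m) (f : 'rV[R]_m -> R) : Prop :=
  forall k, Ck k U f.

Definition smooth_on m q (U : set 'rV[R]_m) (F : 'rV[R]_m -> 'rV[R]_q) : Prop :=
  forall j : 'I_q, smooth_fun U (fun x => F x 0 j).

Definition bilin m (G : 'M[R]_m) (u v : 'rV[R]_m) : R :=
  (u *m G *m v^T) 0 0.

End EuclideanCalculus.

Record manifold (R : realType) (m : nat) := Manifold {
  points :> topologicalType;
  chart : Type;
  dom : chart -> set points;
  chart_map : chart -> points -> 'rV[R]_m;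
  param : chart -> 'rV[R]_m -> points;
  dom_open : forall a, open (dom a);
  chart_map_open : forall a, open (chart_map a @` dom a);
  chart_mapK : forall a p, dom a p -> param a (chart_map a p) = p;
  chart_map_continuous : forall a p, dom a p -> {for p, continuous (chart_map a)};
  param_continuous : forall a p, dom a p ->
    {for chart_map a p, continuous (param a)};
  dom_cover : forall p, exists a, dom a p;
  transition_smooth : forall a b,
    smooth_on (chart_map a @` (dom a `&` dom b)) (chart_map b \o param a);
  manifold_hausdorff : hausdorff_space points;
  manifold_second_countable : @second_countable points
}.

Arguments dom {R m} _ _ _.
Arguments chart_map {R m} _ _ _.
Arguments param {R m} _ _ _.

Section Maps.
Context {R : realType} {m q : nat}.
Variables (M : manifold R m) (N : manifold R q).

Definition chart_repr (f : M -> N) (a : chart M) (b : chart N) :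
  'rV[R]_m -> 'rV[R]_q := chart_map N b \o f \o param M a.

Definition repr_dom (f : M -> N) (a : chart M) (b : chart N) : set 'rV[R]_m :=
  chart_map M a @` (dom M a `&` f @^-1` dom N b).

Definition smooth_map (f : M -> N) : Prop :=
  continuous f /\ forall a b, smooth_on (repr_dom f a b) (chart_repr f a b).

Definition differential (f : M -> N) a b (p : M) : 'M[R]_(m, q) :=
  'J (chart_repr f a b) (chart_map M a p).

Definition immersion (f : M -> N) : Prop :=
  smooth_map f /\
  forall p a b, dom M a p -> dom N b (f p) -> row_free (differential f a b p).

End Maps.

Section RiemannianMetrics.
Context {R : realType} {m : nat}.

(* A tangent vector at [p] is given by its components in every chart around
   [p], subject to the transformation law. *)
Definition tangent (M : manifold R m) (p : M) (v : chart M -> 'rV[R]_m) : Prop :=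
  forall a b, dom M a p -> dom M b p ->
    v b = v a *m differential (@id M) a b p.

(* [gram g p a] is the Gram matrix at [p] of the coordinate basis of the chart
   [a]; it is meaningful only when [p] is in the domain of [a]. *)
Record riem_metric (M : manifold R m) := RiemMetric {
  gram : M -> chart M -> 'M[R]_m;
  gram_sym : forall p a, dom M a p -> (gram p a)^T = gram p a;
  gram_pos : forall p a, dom M a p ->
    forall v, v != 0 -> 0 < bilin (gram p a) v v;
  gram_smooth : forall a i j, smooth_fun (chart_map M a @` dom M a)
    (fun x => gram (param M a x) a i j);
  gram_change : forall p a b, dom M a p -> dom M b p ->
    let J := differential (@id M) a b p in gram p a = J *m gram p b *m J^T
}.

Definition local_metric (M : manifold R m) (g : riem_metric M) (a : chart M) :
  'rV[R]_m -> 'M[R]_m := fun x => gram g (param M a x) a.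

End RiemannianMetrics.

Section Curvature.
Context {R : realType} {m : nat}.
Variable G : 'rV[R]_m -> 'M[R]_m.

(* [christoffel k i j] is the component along e_k of nabla_{e_i} e_j for the
   Levi-Civita connection. *)
Definition christoffel (k i j : 'I_m) (x : 'rV[R]_m) : R :=
  2^-1 * \sum_(l < m) invmx (G x) k l *
    (pd i (fun y => G y j l) x + pd j (fun y => G y i l) x
     - pd l (fun y => G y i j) x).

(* [riemann l i j k] is the component along e_l of R(e_i, e_j) e_k, where
   R(X, Y) = [nabla_X, nabla_Y] - nabla_[X, Y]. *)
Definition riemann (l i j k : 'I_m) (x : 'rV[R]_m) : R :=
  pd i (christoffel l j k) x - pd j (christoffel l i k) x
  + \sum_(s < m) (christoffel l i s x * christoffel s j k x
                  - christoffel l j s x * christoffel s i k x).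

Definition curvature_op (x u v w : 'rV[R]_m) : 'rV[R]_m :=
  \row_l \sum_(i < m) \sum_(j < m) \sum_(k < m)
    u 0 i * v 0 j * w 0 k * riemann l i j k x.

Definition sectional (x u v : 'rV[R]_m) : R :=
  bilin (G x) (curvature_op x u v v) u /
  (bilin (G x) u u * bilin (G x) v v - bilin (G x) u v ^+ 2).

(* Ric(Y, Z) is the trace of X |-> R(X, Y) Z. *)
Definition ricci (x : 'rV[R]_m) : 'M[R]_m :=
  \matrix_(j, k) \sum_(i < m) riemann i i j k x.

Definition ricci_op (x : 'rV[R]_m) : 'M[R]_m := ricci x *m invmx (G x).

End Curvature.

Section SpaceForms.
Context {R : realType} {m : nat}.

Definition path_connected (T : topologicalType) : Prop :=
  forall p q : T, exists gamma : R -> T,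
    {within `[0, 1], continuous gamma} /\ gamma 0 = p /\ gamma 1 = q.

Definition loops_contractible (T : topologicalType) : Prop :=
  forall gamma : R -> T,
    {within `[0, 1], continuous gamma} -> gamma 0 = gamma 1 ->
    exists H : R * R -> T,
      {within `[0, 1] `*` `[0, 1], continuous H} /\
      (forall t : R, t \in `[0, 1] -> H (t, 0) = gamma t /\ H (t, 1) = gamma 0) /\
      (forall s : R, s \in `[0, 1] -> H (0, s) = gamma 0 /\ H (1, s) = gamma 0).

Definition simply_connected (T : topologicalType) : Prop :=
  path_connected T /\ loops_contractible T.

Variables (N : manifold R m) (h : riem_metric N).

Definition geodesic (gamma : R -> N) : Prop :=
  continuous gamma /\
  forall t a, dom N a (gamma t) ->
    let c := chart_map N a \o gamma in
    derivable c t 1 /\ derivable (derive1 c) t 1 /\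
    forall k : 'I_m,
      derive1 (derive1 c) t 0 k
      + \sum_(i < m) \sum_(j < m) christoffel (local_metric h a) k i j (c t)
          * derive1 c t 0 i * derive1 c t 0 j = 0.

Definition geodesically_complete : Prop :=
  forall (p : N) v, tangent p v ->
    exists gamma, geodesic gamma /\ gamma 0 = p /\
      forall a, dom N a p -> derive1 (chart_map N a \o gamma) 0 = v a.

Definition constant_sectional_curvature (c : R) : Prop :=
  forall p a, dom N a p -> forall u v : 'rV[R]_m, row_free (col_mx u v) ->
    sectional (local_metric h a) (chart_map N a p) u v = c.

Definition simply_connected_space_form (c : R) : Prop :=
  [/\ simply_connected N, geodesically_complete &
      constant_sectional_curvature c].

End SpaceForms.

Section Hypersurfaces.
Context {R : realType} {n : nat}.
Variables (M : manifold R n) (N : manifold R n.+1).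
Variables (g : riem_metric M) (h : riem_metric N).
Variables (f : M -> N) (nu : M -> chart N -> 'rV[R]_n.+1).

Definition induced_metric : Prop :=
  forall p a b, dom M a p -> dom N b (f p) ->
    let J := differential f a b p in gram g p a = J *m gram h (f p) b *m J^T.

Definition unit_normal_field : Prop :=
  [/\ forall p, tangent (f p) (nu p),
      forall a b, smooth_on (repr_dom f a b) (fun x => nu (param M a x) b),
      forall p a b, dom M a p -> dom N b (f p) ->
        differential f a b p *m gram h (f p) b *m (nu p b)^T = 0 &
      forall p b, dom N b (f p) -> bilin (gram h (f p) b) (nu p b) (nu p b) = 1].

(* Row i is the derivative of [nu] in the direction e_i with respect to the
   pullback by [f] of the Levi-Civita connection of [h]. *)
Definition normal_derivative a b (p : M) : 'M[R]_(n, n.+1) :=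
  \matrix_(i < n, k < n.+1)
    (pd i (fun x => nu (param M a x) b 0 k) (chart_map M a p)
     + \sum_(r < n.+1) \sum_(s < n.+1)
         christoffel (local_metric h b) k r s (chart_map N b (f p))
         * differential f a b p i r * nu p b 0 s).

(* The shape operator X |-> - (nabla_X nu)^T in the coordinate basis of the
   chart [a], its tangential components being computed from the inner products
   with the coordinate basis. *)
Definition shape_op a b (p : M) : 'M[R]_n :=
  - (normal_derivative a b p *m gram h (f p) b *m (differential f a b p)^T
     *m invmx (gram g p a)).

Definition mean_curvature a b (p : M) : R := n%:R^-1 * \tr (shape_op a b p).

Definition eigenvalues (A : 'M[R]_n) (s : seq R) : Prop :=
  char_poly A = \prod_(x <- s) ('X - x%:P).

(* The matrices below depend on the charts used, but their spectra do not. *)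

Definition isoparametric : Prop :=
  exists s : seq R, forall p a b, dom M a p -> dom N b (f p) ->
    eigenvalues (shape_op a b p) s.

Definition constant_mean_curvature : Prop :=
  exists H : R, forall p a b, dom M a p -> dom N b (f p) ->
    mean_curvature a b p = H.

Definition constant_ricci_eigenvalues : Prop :=
  exists s : seq R, forall p a, dom M a p ->
    eigenvalues (ricci_op (local_metric g a) (chart_map M a p)) s.

End Hypersurfaces.

(* Main.v *)
From HB Require Import structures.
Require Import Defs.
From mathcomp Require Import all_boot all_order all_algebra.
From mathcomp Require Import all_classical all_reals all_analysis.
From mathcomp Require Import ring lra complex.
Local Open Scope classical_set_scope.
Local Open Scope ring_scope.

(** The trace of the shape operator [A] is a coefficient of its characteristic
    polynomial, so an isoparametric hypersurface has constant mean curvature.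

    For the converse, contracting the Gauss equation in a space of constant
    curvature [c] gives the identity of operators
    [Ric = c (n - 1) + (tr A) A - A ^ 2] ([ricci_op_gauss]). If [tr A] is
    constant and the eigenvalues of [Ric] belong to a fixed list, each principal
    curvature solves one of finitely many fixed quadratic equations
    ([char_poly_finite]). The characteristic polynomial of [A] thus takes
    finitely many values; its values at any number depend continuously on the
    point, so it is locally constant
    ([char_poly_shape_locally_constant]), hence constant on a connected
    hypersurface. Its roots are real because [A] is self-adjoint for the
    induced metric ([char_poly_selfadjoint]).

    The geometry is carried out in coordinates with matrix-valued functions. A
    connection is a family of matrices acting on rows, covariant
    differentiation along a map [F] is [nabla], and the three properties of the
    Levi-Civita connection used throughout are its compatibility with the metric
    ([nabla_compat]), the symmetry of the derivatives of a coordinate frame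
    ([nabla_frame_sym]), and the commutation of covariant derivatives up to
    curvature ([nabla_comm]). The Koszul formula
    [nabla_frame_tangential] follows from the first two, and the Gauss equation
    from differentiating it once more ([gauss_equation]).

    Two further facts are needed. A tensor with the symmetries of a curvature
    tensor is determined by its sectional values ([curv_form_flat]), which puts
    the ambient curvature in the standard form. And the characteristic
    polynomial of [A] must not depend on the charts in which it is computed
    ([char_poly_shape_charts]), so that it is a function on the hypersurface; for
    the target chart this rests on the Koszul formula applied to the transition
    map, which is an isometry ([nabla_isometry]). *)

Set Implicit Arguments.
Unset Strict Implicit.
Unset Printing Implicit Defensive.

Import Order.TTheory GRing.Theory Num.Theory.
Import numFieldNormedType.Exports.

(** * Partial derivatives *)

Section PartialDerivatives.
Context {R : realType} {m : nat}.
Implicit Types (f g : 'rV[R]_m -> R) (x : 'rV[R]_m) (i : 'I_m).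

Lemma near_eq_pd f g x i : (\near x, f x = g x) -> pd i f x = pd i g x.
Proof. exact: near_eq_derive. Qed.

Lemma eq_pd f g x i : f =1 g -> pd i f x = pd i g x.
Proof. by move=> /funext ->. Qed.

Lemma pd_cst (c : R) x i : pd i (fun=> c) x = 0.
Proof. by rewrite /pd derive_cst. Qed.

Lemma pdD f g x i : differentiable f x -> differentiable g x ->
  pd i (fun y => f y + g y) x = pd i f x + pd i g x.
Proof. by move=> df dg; rewrite /pd (@deriveD _ _ _ f g) //; exact: diff_derivable. Qed.

Lemma pdM f g x i : differentiable f x -> differentiable g x ->
  pd i (fun y => f y * g y) x = pd i f x * g x + f x * pd i g x.
Proof.
move=> df dg; rewrite /pd (@deriveM _ _ f g); try exact: diff_derivable.
by rewrite addrC; congr (_ + _); rewrite -[LHS]/(_ * _) mulrC.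
Qed.

Lemma differentiable_sumf (I : finType) (F : I -> 'rV[R]_m -> R) x :
  (forall k, differentiable (F k) x) ->
  differentiable (fun y => \sum_k F k y) x.
Proof.
move=> dF.
have -> : (fun y => \sum_k F k y) = \sum_k F k.
  by apply/funext => y; rewrite fct_sumE.
elim/big_ind: _ => // f g df dg; exact: differentiableD.
Qed.

Lemma pd_sum (I : finType) (F : I -> 'rV[R]_m -> R) x i :
  (forall k, differentiable (F k) x) ->
  pd i (fun y => \sum_k F k y) x = \sum_k pd i (F k) x.
Proof.
move=> dF.
have H (r : seq I) : differentiable (fun y => \sum_(k <- r) F k y) x /\
  pd i (fun y => \sum_(k <- r) F k y) x = \sum_(k <- r) pd i (F k) x.
  elim: r => [|a r [IH1 IH2]].
    rewrite big_nil; have -> : (fun y => \sum_(k <- [::]) F k y) = fun=> 0.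
      by apply/funext => y; rewrite big_nil.
    by split; [exact: (differentiable_cst (0 : R))|exact: pd_cst].
  have -> : (fun y => \sum_(k <- a :: r) F k y) =
            fun y => F a y + \sum_(k <- r) F k y.
    by apply/funext => y; rewrite big_cons.
  split; first exact: differentiableD.
  by rewrite pdD // IH2 big_cons.
by have [_] := H (index_enum I).
Qed.
End PartialDerivatives.

Section VectorValued.
Context {R : realType} {m q : nat}.

Lemma differentiable_rowP (F : 'rV[R]_q -> 'rV[R]_m) x :
  (forall r, differentiable (fun y => F y 0 r) x) -> differentiable F x.
Proof.
move=> dF.
have -> : F = \sum_r (fun y => F y 0 r *: delta_mx 0 r).
  by apply/funext => y; rewrite fct_sumE -row_sum_delta.
by apply: differentiable_sum => r; apply: differentiableZl.
Qed.

Lemma jacobianE (F : 'rV[R]_q -> 'rV[R]_m) x i r :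
  (forall r, differentiable (fun y => F y 0 r) x) ->
  ('J F x) i r = pd i (fun y => F y 0 r) x.
Proof.
move=> dF; have dFx := differentiable_rowP dF.
rewrite /pd deriveE; last exact: dF.
rewrite (_ : (fun y => F y 0 r) = (fun N : 'rV[R]_m => N 0 r) \o F) //.
rewrite diff_comp //; last exact: differentiable_coord.
have lcoord : linear (fun N : 'rV[R]_m => N 0 r) by move=> a u w; rewrite !mxE.
pose coord : {linear 'rV[R]_m -> R} :=
  HB.pack (fun N : 'rV[R]_m => N 0 r) (GRing.isLinear.Build _ _ _ _ _ lcoord).
rewrite /= (_ : 'd (fun N : 'rV[R]_m => N 0 r) (F x) = coord :> (_ -> _)).
  by rewrite /jacobian !mxE.
by rewrite (@diff_lin _ _ _ coord) //; exact: coord_continuous.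
Qed.

Lemma pd_comp (f : 'rV[R]_m -> R) (F : 'rV[R]_q -> 'rV[R]_m) x i :
  (forall r, differentiable (fun y => F y 0 r) x) -> differentiable f (F x) ->
  pd i (fun y => f (F y)) x = \sum_r ('J F x) i r * pd r f (F x).
Proof.
move=> dF df; have dFx := differentiable_rowP dF.
rewrite /pd deriveE; last exact: (differentiable_comp dFx df).
rewrite -[fun y => _]/(f \o F) diff_comp //=.
have -> : 'd F x (delta_mx 0 i) = \sum_r ('J F x) i r *: delta_mx 0 r.
  rewrite [LHS]row_sum_delta; apply: eq_bigr => r _; congr (_ *: _).
  by rewrite /jacobian !mxE.
by rewrite linear_sum; apply: eq_bigr => r _; rewrite linearZ /= deriveE.
Qed.

Lemma differentiable_compf (f : 'rV[R]_m -> R) (F : 'rV[R]_q -> 'rV[R]_m) x :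
  (forall r, differentiable (fun y => F y 0 r) x) -> differentiable f (F x) ->
  differentiable (fun y => f (F y)) x.
Proof. by move=> /differentiable_rowP dF df; exact: (differentiable_comp dF df). Qed.

End VectorValued.

(** * Symmetry of second partial derivatives *)

Section Schwarz.
Context {R : realType} {m : nat}.
Implicit Types (f : 'rV[R]_m -> R) (x u v : 'rV[R]_m) (U : set 'rV[R]_m).

Lemma is_derive_line f u x (s : R) : differentiable f (s *: u + x) ->
  is_derive s 1 (fun t : R => f (t *: u + x)) ('D_u f (s *: u + x)).
Proof.
move=> df.
have dl : is_diff s (fun t : R => t *: u + x) (fun t => t *: u).
  have /= := @is_diffD _ _ _ ( *:%R^~ u : R -> 'rV[R]_m) (cst x) _ _ s
    (is_diff_scalel s u) (is_diff_cst x s).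
  by rewrite addr0.
have dc : differentiable (f \o (fun t : R => t *: u + x)) s.
  exact: differentiable_comp.
apply: DeriveDef; first exact: diff_derivable.
rewrite deriveE // -[fun t => _]/(f \o (fun t : R => t *: u + x)).
by rewrite diff_comp //= (@diff_val _ _ _ _ _ _ _ dl) scale1r deriveE.
Qed.

Lemma mvt_line f u x (h : R) : 0 < h ->
  (forall s, 0 <= s <= h -> differentiable f (s *: u + x)) ->
  exists2 s, 0 <= s <= h & f (h *: u + x) - f x = h * 'D_u f (s *: u + x).
Proof.
move=> h0 df.
have [||s] := @MVT R (fun t => f (t *: u + x)) (fun s => 'D_u f (s *: u + x)) 0 h h0.
- move=> s /[!in_itv]/= /andP[s0 sh]; apply: is_derive_line; apply: df.
  by rewrite !ltW.
- apply: derivable_within_continuous => s /[!in_itv]/= /df.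
  by move=> /is_derive_line[].
- rewrite in_itv/= => /andP[s0 sh] E; exists s; first by rewrite !ltW.
  by rewrite scale0r add0r subr0 mulrC in E.
Qed.

Lemma derive_shiftl f u a x : 'D_u (fun y => f (a + y)) x = 'D_u f (a + x).
Proof.
rewrite /derive; apply: (congr1 (fun k : R -> R => lim (k @ 0^'))).
by apply/funext => k /=; rewrite addrCA.
Qed.

(** The mean value theorem, applied first in the direction [u] and then in the
    direction [v], turns a second difference over a small parallelogram into a
    mixed second derivative at an intermediate point. *)
Lemma second_difference f U u v x (h : R) : 0 < h ->
  (forall y, U y -> differentiable f y) ->
  (forall y, U y -> differentiable ('D_u f) y) ->
  (forall s t, 0 <= s <= h -> 0 <= t <= h -> U (t *: v + (s *: u + x))) ->
  exists s t, [/\ 0 <= s <= h, 0 <= t <= h &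
   f (h *: v + (h *: u + x)) - f (h *: u + x) - (f (h *: v + x) - f x)
   = h * (h * 'D_v ('D_u f) (t *: v + (s *: u + x)))].
Proof.
move=> h0 df ddf UU.
have h00 : 0 <= h <= h by rewrite lexx ltW.
have z0 : 0 <= (0 : R) <= h by rewrite lexx ltW.
have df1 s : 0 <= s <= h -> differentiable f (s *: u + (h *: v + x)).
  by move=> sh; apply: df; rewrite addrCA; exact: UU.
have df2 s : 0 <= s <= h -> differentiable f (s *: u + x).
  by move=> sh; apply: df; rewrite -[_ + _]add0r -(scale0r v); exact: UU.
pose phi y := f (h *: v + y) - f y.
have dsh s : 0 <= s <= h -> differentiable (fun y => f (h *: v + y)) (s *: u + x).
  move=> sh; apply: (@differentiable_comp _ _ _ _ (fun y => h *: v + y) f).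
    exact: (@differentiableD _ _ _ (cst _) id).
  by rewrite addrCA; exact: df1.
have [s sh E1] : exists2 s, 0 <= s <= h &
    phi (h *: u + x) - phi x = h * 'D_u phi (s *: u + x).
  by apply: mvt_line => // s sh; apply: differentiableB; [exact: dsh|exact: df2].
have E2 : 'D_u phi (s *: u + x) =
   'D_u f (h *: v + (s *: u + x)) - 'D_u f (s *: u + x).
  rewrite (@deriveB _ _ _ (fun y => f (h *: v + y)) f); first last.
  - exact: (diff_derivable (df2 _ sh)).
  - exact: (diff_derivable (dsh _ sh)).
  by rewrite derive_shiftl.
have [t th E3] := @mvt_line ('D_u f) v (s *: u + x) h h0
  (fun t th => ddf _ (UU s t sh th)).
by exists s, t; split => //; rewrite -E3 -E2 -E1.
Qed.

Lemma continuous_dist_lt f x (e : R) : 0 < e -> {for x, continuous f} ->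
  nbhs x (fun y => `|f x - f y| < e).
Proof. by move=> e0 /cvgrPdist_lt/(_ _ e0). Qed.

(** The second difference is symmetric in the two directions, so the two mixed
    derivatives agree at two points of every small ball, hence at its centre by
    continuity. *)
Lemma derive_comm f U u v x : open U -> U x ->
  (forall y, U y -> differentiable f y) ->
  (forall y, U y -> differentiable ('D_u f) y) ->
  (forall y, U y -> differentiable ('D_v f) y) ->
  {for x, continuous ('D_v ('D_u f))} ->
  {for x, continuous ('D_u ('D_v f))} ->
  'D_v ('D_u f) x = 'D_u ('D_v f) x.
Proof.
move=> oU Ux df duf dvf cP cQ; apply/eqP; rewrite -subr_eq0 -normr_le0.
apply/ler_addgt0Pl => e e0; rewrite addr0.
have e20 : 0 < e / 2 by rewrite divr_gt0.
have h1 : nbhs x U by exact: open_nbhs_nbhs.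
have h2 := continuous_dist_lt e20 cP.
have h3 := continuous_dist_lt e20 cQ.
have [r /= r0 Hr] := iffLR (@nbhs_ballP R 'rV[R]_m x _) (filterI h1 (filterI h2 h3)).
pose C := `|u| + `|v| + 1.
have C0 : 0 < C by rewrite ltr_wpDl // addr_ge0.
(* A step small enough to keep both parallelograms inside the ball. *)
pose h := r / (2 * C).
have h0 : 0 < h by rewrite divr_gt0 // mulr_gt0.
have inb s t : 0 <= s <= h -> 0 <= t <= h -> ball x r (t *: v + (s *: u + x)).
  move=> /andP[s0 sh] /andP[t0 th].
  rewrite -ball_normE /ball_ /= addrA opprD addrCA subrr addr0 normrN.
  apply: (le_lt_trans (ler_normD _ _)); rewrite !normrZ !ger0_norm //.
  apply: (@le_lt_trans _ _ (h * C)).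
    rewrite /C !mulrDr mulr1 addrC -addrA; apply: lerD.
      exact: ler_wpM2r.
    by rewrite -[leLHS]addr0; apply: lerD; [exact: ler_wpM2r|exact: ltW].
  by rewrite /h invfM mulrA divfK ?gt_eqF // ltr_pdivrMr // ltr_pMr // ltr1n.
have [s [t [sh th E]]] := second_difference h0 df duf
  (fun s t sh th => proj1 (Hr _ (inb s t sh th))).
have inb' s' t' : 0 <= s' <= h -> 0 <= t' <= h -> ball x r (t' *: u + (s' *: v + x)).
  by move=> sh' th'; rewrite addrCA; exact: inb.
have [s' [t' [sh' th' E']]] := second_difference h0 df dvf
  (fun s t sh th => proj1 (Hr _ (inb' s t sh th))).
have EE : 'D_v ('D_u f) (t *: v + (s *: u + x)) =
          'D_u ('D_v f) (t' *: u + (s' *: v + x)).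
  apply: (mulfI (lt0r_neq0 h0)); apply: (mulfI (lt0r_neq0 h0)).
  apply: etrans (esym E) (etrans _ E').
  rewrite (_ : h *: u + (h *: v + x) = h *: v + (h *: u + x)); last exact: addrCA.
  move: (f (h *: v + (h *: u + x))) (f (h *: u + x)) (f (h *: v + x)) (f x).
  move=> a b c d; ring.
have [_ [B1 _]] := Hr _ (inb s t sh th).
have [_ [_ B2]] := Hr _ (inb' s' t' sh' th').
rewrite -EE distrC in B2.
rewrite -(subrKA ('D_v ('D_u f) (t *: v + (s *: u + x)))).
apply: (le_trans (ler_normD _ _)); rewrite (splitr e).
exact: (lerD (ltW B1) (ltW B2)).
Qed.
End Schwarz.

Section Smooth.
Context {R : realType} {m : nat} (U : set 'rV[R]_m).
Implicit Types f : 'rV[R]_m -> R.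

Lemma smooth_differentiable f x : smooth_fun U f -> U x -> differentiable f x.
Proof. by move=> /(_ 1%N)[+ _]; exact. Qed.

Lemma smooth_pd f i : smooth_fun U f -> smooth_fun U (pd i f).
Proof. by move=> sf k; have /= [_] := sf k.+1; exact. Qed.

Lemma pd_comm f i j x : open U -> smooth_fun U f -> U x ->
  pd i (pd j f) x = pd j (pd i f) x.
Proof.
move=> oU sf Ux; apply: (derive_comm oU Ux).
- by move=> y Uy; exact: smooth_differentiable.
- by move=> y Uy; apply: smooth_differentiable => //; exact: smooth_pd.
- by move=> y Uy; apply: smooth_differentiable => //; exact: smooth_pd.
- exact: ((smooth_pd i (smooth_pd j sf)) 0%N).
- exact: ((smooth_pd j (smooth_pd i sf)) 0%N).
Qed.
End Smooth.

(** * Differentiation of matrix-valued functions *)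

(** The expansion defining the differential involves only the germ of the
    function. This is what allows formulas valid on an open set, such as the
    one for an inverse matrix, to be differentiated. *)
Lemma near_eq_differentiable (R : realType) (V W : normedModType R)
    (f g : V -> W) (x : V) : (\forall y \near x, f y = g y) ->
  differentiable f x -> differentiable g x.
Proof.
move=> fg df; have fgx : f x = g x := nbhs_singleton fg.
have fg0 : \forall h \near (0 : V), f (h + x) = g (h + x).
  have c : (fun h : V => h + x) @ (0 : V) --> x.
    by rewrite -[X in _ --> X]add0r; apply: cvgD; [exact: cvg_id|exact: cvg_cst].
  exact: (c _ fg).
have E : g \o shift x = cst (g x) + 'd f x +o_ (0 : V) id.
  apply/eqaddoP => e e0; have /eqaddoP/(_ e e0) := diff_locally df.
  apply: filterS2 fg0 => h Eh; rewrite -fgx.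
  suff -> : (g \o shift x - (cst (f x) + 'd f x)) h =
            (f \o shift x - (cst (f x) + 'd f x)) h by [].
  by rewrite !fctE /= Eh.
have dfc := diff_continuous df.
by apply/diff_locallyP; rewrite (diff_unique dfc E).
Qed.

Section Entries.
Context {V : zmodType} {p q : nat}.
Implicit Types A B : 'M[V]_(p, q).

Lemma addmxE A B r s : (A + B) r s = A r s + B r s. Proof. by rewrite mxE. Qed.

Lemma oppmxE A r s : (- A) r s = - A r s. Proof. by rewrite mxE. Qed.

Lemma addmx_tr A B : (A + B)^T = A^T + B^T.
Proof. by apply/matrixP => r s; rewrite !mxE. Qed.

Lemma oppmx_tr A : (- A)^T = - A^T.
Proof. by apply/matrixP => r s; rewrite !mxE. Qed.
End Entries.

Lemma scalemxE (R : pzRingType) p q (a : R) (A : 'M[R]_(p, q)) r s :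
  (a *: A) r s = a * A r s.
Proof. by rewrite mxE. Qed.

Section MatrixFunctions.
Context {R : realType} {m : nat}.
Implicit Types (x : 'rV[R]_m) (i : 'I_m).

Definition mdiff p q (A : 'rV[R]_m -> 'M[R]_(p, q)) x :=
  forall r s, differentiable (fun y => A y r s) x.

Definition mpd p q i (A : 'rV[R]_m -> 'M[R]_(p, q)) x : 'M[R]_(p, q) :=
  \matrix_(r, s) pd i (fun y => A y r s) x.

Lemma near_eq_mpd p q i (A B : 'rV[R]_m -> 'M[R]_(p, q)) x :
  (\near x, A x = B x) -> mpd i A x = mpd i B x.
Proof.
move=> AB; apply/matrixP => r s; rewrite !mxE; apply: near_eq_pd.
by apply: filterS AB => y ->.
Qed.

Lemma differentiableMf (f g : 'rV[R]_m -> R) x :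
  differentiable f x -> differentiable g x ->
  differentiable (fun y => f y * g y) x.
Proof. by move=> df dg; exact: (differentiableM df dg). Qed.

Section Ops.
Variables (p q : nat) (x : 'rV[R]_m) (i : 'I_m).
Implicit Types A B : 'rV[R]_m -> 'M[R]_(p, q).

Lemma mdiff_cst (C : 'M[R]_(p, q)) : mdiff (fun=> C) x.
Proof. by move=> r s; exact: differentiable_cst. Qed.

Lemma mdiffD A B : mdiff A x -> mdiff B x -> mdiff (fun y => A y + B y) x.
Proof.
move=> dA dB r s; rewrite (_ : (fun y => _) = (fun y => A y r s + B y r s)).
  exact: (differentiableD (dA r s) (dB r s)).
by apply/funext => y; rewrite mxE.
Qed.

Lemma mdiffN A : mdiff A x -> mdiff (fun y => - A y) x.
Proof.
move=> dA r s; rewrite (_ : (fun y => _) = (fun y => - A y r s)).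
  exact: (differentiableN (dA r s)).
by apply/funext => y; rewrite mxE.
Qed.

Lemma mdiffZ (f : 'rV[R]_m -> R) A : differentiable f x -> mdiff A x ->
  mdiff (fun y => f y *: A y) x.
Proof.
move=> df dA r s; rewrite (_ : (fun y => _) = (fun y => f y * A y r s)).
  exact: (differentiableMf df (dA r s)).
by apply/funext => y; rewrite mxE.
Qed.

Lemma mdiff_tr A : mdiff A x -> mdiff (fun y => (A y)^T) x.
Proof.
move=> dA r s; rewrite (_ : (fun y => _) = (fun y => A y s r)) //.
by apply/funext => y; rewrite mxE.
Qed.

Lemma mdiff_sum (I : finType) (F : I -> 'rV[R]_m -> 'M[R]_(p, q)) :
  (forall k, mdiff (F k) x) -> mdiff (fun y => \sum_k F k y) x.
Proof.
move=> dF r s; rewrite (_ : (fun y => _) = (fun y => \sum_k F k y r s)).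
  by apply: differentiable_sumf => k; exact: dF.
by apply/funext => y; rewrite summxE.
Qed.

Lemma mpdD A B : mdiff A x -> mdiff B x ->
  mpd i (fun y => A y + B y) x = mpd i A x + mpd i B x.
Proof.
move=> dA dB; apply/matrixP => r s; rewrite !mxE -pdD //; apply: eq_pd => y.
by rewrite mxE.
Qed.

Lemma mpdZ (f : 'rV[R]_m -> R) A : differentiable f x -> mdiff A x ->
  mpd i (fun y => f y *: A y) x = pd i f x *: A x + f x *: mpd i A x.
Proof.
move=> df dA; apply/matrixP => r s; rewrite !mxE -pdM //; apply: eq_pd => y.
by rewrite mxE.
Qed.

Lemma mpd_tr A : mpd i (fun y => (A y)^T) x = (mpd i A x)^T.
Proof.
apply/matrixP => r s; rewrite !mxE; apply: eq_pd => y.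
by rewrite mxE.
Qed.

Lemma mpd_sum (I : finType) (F : I -> 'rV[R]_m -> 'M[R]_(p, q)) :
  (forall k, mdiff (F k) x) ->
  mpd i (fun y => \sum_k F k y) x = \sum_k mpd i (F k) x.
Proof.
move=> dF; apply/matrixP => r s; rewrite summxE !mxE.
under [RHS]eq_bigr do rewrite mxE.
rewrite -pd_sum; last by move=> k; exact: dF.
by apply: eq_pd => y; rewrite summxE.
Qed.

End Ops.

Lemma mdiffM p q l (A : 'rV[R]_m -> 'M[R]_(p, q)) (B : 'rV[R]_m -> 'M[R]_(q, l)) x :
  mdiff A x -> mdiff B x -> mdiff (fun y => A y *m B y) x.
Proof.
move=> dA dB r s.
rewrite (_ : (fun y => _) = (fun y => \sum_k A y r k * B y k s)).
  by apply: differentiable_sumf => k; exact: differentiableMf.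
by apply/funext => y; rewrite mxE.
Qed.

Lemma mpdM p q l i (A : 'rV[R]_m -> 'M[R]_(p, q)) (B : 'rV[R]_m -> 'M[R]_(q, l)) x :
  mdiff A x -> mdiff B x ->
  mpd i (fun y => A y *m B y) x = mpd i A x *m B x + A x *m mpd i B x.
Proof.
move=> dA dB; apply/matrixP => r s; rewrite !mxE -big_split /=.
rewrite (_ : (fun y => _) = (fun y => \sum_k A y r k * B y k s)); last first.
  by apply/funext => y; rewrite mxE.
rewrite pd_sum; last by move=> k; exact: differentiableMf.
by apply: eq_bigr => k _; rewrite pdM // !mxE.
Qed.

Lemma differentiable_prod (I : finType) (P : pred I) (F : I -> 'rV[R]_m -> R) x :
  (forall k, differentiable (F k) x) ->
  differentiable (fun y => \prod_(k | P k) F k y) x.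
Proof.
move=> dF; have -> : (fun y => \prod_(k | P k) F k y) =
    fun y => \prod_(k <- index_enum I | P k) F k y by [].
elim: (index_enum I) => [|a r IH].
  rewrite (_ : (fun y => _) = fun=> 1).
    exact: (differentiable_cst (1 : R)).
  by apply/funext => y; rewrite big_nil.
case Pa: (P a).
  rewrite (_ : (fun y => _) = fun y => F a y * \prod_(k <- r | P k) F k y).
    exact: differentiableMf.
  by apply/funext => y; rewrite big_cons Pa.
rewrite (_ : (fun y => _) = fun y => \prod_(k <- r | P k) F k y) //.
by apply/funext => y; rewrite big_cons Pa.
Qed.

Lemma differentiable_det p (A : 'rV[R]_m -> 'M[R]_p) x :
  mdiff A x -> differentiable (fun y => \det (A y)) x.
Proof.
move=> dA; apply: differentiable_sumf => s; apply: differentiableMf.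
  exact: differentiable_cst.
by apply: differentiable_prod => k; exact: dA.
Qed.

(** By Cramer's rule the entries are quotients of polynomials in those of [A]
    wherever the determinant does not vanish. *)
Lemma mdiff_inv p (A : 'rV[R]_m -> 'M[R]_p) x :
  mdiff A x -> (\near x, A x \in unitmx) -> mdiff (fun y => invmx (A y)) x.
Proof.
move=> dA uA r s.
apply: (@near_eq_differentiable _ _ _ (fun y => (\det (A y))^-1 * (\adj (A y)) r s)).
  by apply: filterS uA => y uy; rewrite /invmx uy [RHS]mxE.
apply: differentiableMf.
  apply: differentiableV; first exact: differentiable_det.
  by move: (nbhs_singleton uA); rewrite unitmxE unitfE.
rewrite (_ : (fun y => _) = (fun y => cofactor (A y) s r)); last first.
  by apply/funext => y; rewrite mxE.
apply: differentiableMf; first exact: differentiable_cst.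
apply: differentiable_det => k l.
rewrite (_ : (fun y => _) = (fun y => A y (lift s k) (lift r l))) //.
by apply/funext => y; rewrite !mxE.
Qed.

End MatrixFunctions.

(** * The Levi-Civita connection in matrix form *)

Section LeviCivita.
Context {R : realType} {m : nat}.
Implicit Types (G : 'rV[R]_m -> 'M[R]_m) (x : 'rV[R]_m) (U : set 'rV[R]_m).

Definition metric_on U G : Prop :=
  [/\ open U,
      forall x, U x -> (G x)^T = G x,
      forall x, U x -> forall v, v != 0 -> 0 < bilin (G x) v v &
      forall j k, smooth_fun U (fun x => G x j k)].

(** The Christoffel symbols of the first kind. *)
Definition christoffel1 G i x : 'M[R]_m :=
  \matrix_(j, l) (2^-1 * (pd i (fun y => G y j l) x + pd j (fun y => G y i l) x
                          - pd l (fun y => G y i j) x)).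

(** The connection form in the coordinate frame: vectors being rows, the
    covariant derivative of a field [X] along [e_i] is
    [d_i X + X *m conn G i]. Treating the lower index [j] and the upper index
    [k] as a matrix turns sums of products of Christoffel symbols into matrix
    products. *)
Definition conn G i x : 'M[R]_m := \matrix_(j, k) christoffel G k i j x.

(** The curvature form, with the signs of a connection acting on rows from the
    right. *)
Definition curv G i j x : 'M[R]_m :=
  mpd i (conn G j) x - mpd j (conn G i) x
  + conn G j x *m conn G i x - conn G i x *m conn G j x.

Lemma curvE G i j x k l : curv G i j x k l =
  mpd i (conn G j) x k l - mpd j (conn G i) x k l
  + (conn G j x *m conn G i x) k l - (conn G i x *m conn G j x) k l.
Proof.
rewrite /curv; move: (mpd i _ x) (mpd j _ x) (_ *m _) (_ *m _) => A B C D.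
by rewrite !mxE.
Qed.

Lemma curv_riemann G i j k l x : curv G i j x k l = riemann G l i j k x.
Proof.
have E a b : mpd a (conn G b) x k l = pd a (christoffel G l b k) x.
  by rewrite mxE; apply: eq_pd => y; rewrite mxE.
have F a b : (conn G b x *m conn G a x) k l =
    \sum_(s < m) christoffel G l a s x * christoffel G s b k x.
  by rewrite mxE; apply: eq_bigr => s _; rewrite !mxE mulrC.
by rewrite curvE /riemann sumrB addrA -!F -!E.
Qed.

Lemma conn_mx G i x j k : conn G i x j k = christoffel G k i j x.
Proof. by rewrite mxE. Qed.

Lemma curv_antisym G i j x : curv G j i x = - curv G i j x.
Proof.
rewrite /curv; move: (mpd i _ x) (mpd j _ x) (_ *m _) (_ *m _) => A B C D.
by apply/matrixP => r s; rewrite !mxE; ring.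
Qed.

Lemma curv_mx G i j x : curv G i j x = mpd i (conn G j) x - mpd j (conn G i) x
  + conn G j x *m conn G i x - conn G i x *m conn G j x.
Proof. by []. Qed.

Lemma posdef_unit (A : 'M[R]_m) : (forall v, v != 0 -> 0 < bilin A v v) ->
  A \in unitmx.
Proof.
move=> pA; rewrite -row_free_unit -kermx_eq0; apply/rowV0P => v /sub_kermxP vA.
apply/eqP/negPn/negP => /pA; rewrite /bilin vA mul0mx mxE ltxx //.
Qed.

Section OnU.
Variables (U : set 'rV[R]_m) (G : 'rV[R]_m -> 'M[R]_m).
Hypothesis mG : metric_on U G.
Variable x : 'rV[R]_m.
Hypothesis Ux : U x.

Lemma metric_on_nbhs : nbhs x U.
Proof. by case: mG => oU _ _ _; exact: open_nbhs_nbhs. Qed.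

Lemma metric_on_unit : G x \in unitmx.
Proof. by case: mG => _ _ p _; apply: posdef_unit; exact: p. Qed.

Lemma metric_on_tr : (G x)^T = G x.
Proof. by case: mG => _ s _ _; exact: s. Qed.

Lemma mdiff_metric : mdiff G x.
Proof. by case: mG => _ _ _ s j k; exact: (smooth_differentiable (s j k)). Qed.

Lemma pd_metric_sym i j k :
  pd i (fun y => G y j k) x = pd i (fun y => G y k j) x.
Proof.
apply: near_eq_pd; case: mG => _ s _ _.
by apply: filterS metric_on_nbhs => y /s {1}<-; rewrite mxE.
Qed.

Lemma connE i : conn G i x = christoffel1 G i x *m invmx (G x).
Proof.
have iT : (invmx (G x))^T = invmx (G x) by rewrite trmx_inv metric_on_tr.
apply/matrixP => j k; rewrite conn_mx mxE /christoffel mulr_sumr.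
by apply: eq_bigr => l _; rewrite -[in LHS]iT !mxE; ring.
Qed.

Lemma conn_metric i : conn G i x *m G x = christoffel1 G i x.
Proof. by rewrite connE mulmxKV // metric_on_unit. Qed.

Lemma metric_conn i : G x *m (conn G i x)^T = (christoffel1 G i x)^T.
Proof. by rewrite -{1}metric_on_tr -trmx_mul conn_metric. Qed.

(** Parallelism of the metric. *)
Lemma conn_compat i : mpd i G x = conn G i x *m G x + G x *m (conn G i x)^T.
Proof.
rewrite conn_metric metric_conn; apply/matrixP => j l; rewrite !mxE.
by rewrite (pd_metric_sym i l j) (pd_metric_sym j i l) (pd_metric_sym l i j); field.
Qed.

(** Absence of torsion. *)
Lemma conn_sym i j k : conn G i x j k = conn G j x i k.
Proof.
rewrite !conn_mx /christoffel; congr (_ * _); apply: eq_bigr => l _.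
by rewrite (pd_metric_sym l i j); ring.
Qed.

Lemma mdiff_christoffel1 i : mdiff (christoffel1 G i) x.
Proof.
case: mG => _ _ _ s j l.
have d a b c : differentiable (pd a (fun y => G y b c)) x.
  by apply: smooth_differentiable Ux; exact: smooth_pd.
rewrite (_ : (fun y => _) = (fun y => 2^-1 *
  (pd i (fun y => G y j l) y + pd j (fun y => G y i l) y
   - pd l (fun y => G y i j) y))).
  apply: differentiableMf; first exact: differentiable_cst.
  exact: (differentiableB (differentiableD (d _ _ _) (d _ _ _)) (d _ _ _)).
by apply/funext => y; rewrite mxE.
Qed.
End OnU.

Section OnU2.
Variables (U : set 'rV[R]_m) (G : 'rV[R]_m -> 'M[R]_m).
Hypothesis mG : metric_on U G.

Lemma mdiff_invmetric x : U x -> mdiff (fun y => invmx (G y)) x.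
Proof.
move=> Ux; apply: mdiff_inv; first exact: (mdiff_metric mG).
by apply: filterS (metric_on_nbhs mG Ux) => y; exact: metric_on_unit.
Qed.

Lemma mdiff_conn i x : U x -> mdiff (conn G i) x.
Proof.
move=> Ux r s.
apply: (@near_eq_differentiable _ _ _
   (fun y => (christoffel1 G i y *m invmx (G y)) r s)).
  by apply: filterS (metric_on_nbhs mG Ux) => y Uy; rewrite (connE mG Uy).
apply: mdiffM; first exact: (mdiff_christoffel1 mG).
exact: mdiff_invmetric.
Qed.

(** The commutator of two derivatives of the metric is both zero, by Schwarz,
    and, by parallelism, the action of the curvature on both arguments. *)
Lemma curv_skew i j x : U x ->
  (curv G i j x *m G x)^T = - (curv G i j x *m G x).
Proof.
move=> Ux; have [oU _ _ sG] := mG.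
have dG := mdiff_metric mG Ux; have dc k := mdiff_conn k Ux.
have E a b : mpd a (mpd b G) x = mpd a (conn G b) x *m G x + conn G b x *m mpd a G x
    + (mpd a G x *m (conn G b x)^T + G x *m (mpd a (conn G b) x)^T).
  rewrite (@near_eq_mpd _ _ _ _ _ _ (fun y => conn G b y *m G y + G y *m (conn G b y)^T)).
    rewrite mpdD; try (apply: mdiffM => //; exact: mdiff_tr).
    by rewrite !mpdM ?mpd_tr //; exact: mdiff_tr.
  by apply: filterS (metric_on_nbhs mG Ux) => y Uy; exact: (conn_compat mG Uy b).
have S : mpd i (mpd j G) x = mpd j (mpd i G) x.
  apply/matrixP => r s; rewrite [LHS]mxE [RHS]mxE.
  have e a b : pd a (fun y => mpd b G y r s) x = pd a (pd b (fun y => G y r s)) x.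
    by apply: eq_pd => y; rewrite mxE.
  by rewrite !e; exact: (pd_comm _ _ oU).
apply/eqP; rewrite -addr_eq0 trmx_mul (metric_on_tr mG Ux) addrC; apply/eqP.
move: S; rewrite (E i j) (E j i) (conn_compat mG Ux i) (conn_compat mG Ux j) curv_mx.
move: (mpd i (conn G j) x) (mpd j (conn G i) x) (conn G i x) (conn G j x) (G x).
move=> A B P Q g.
rewrite !(addmx_tr, oppmx_tr, trmx_mul) !mulmxDl !mulmxDr !mulNmx !mulmxN !mulmxA.
move=> S; apply/matrixP => r s; have := congr1 (fun M : 'M[R]_m => M r s) S.
by rewrite !(addmxE, oppmxE) => S'; rewrite [RHS]mxE; lra.
Qed.

(** The first Bianchi identity: by absence of torsion the derivative terms and
    the quadratic terms are each invariant under an exchange of two indices, and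
    cancel in pairs in the cyclic sum. *)
Lemma curv_bianchi i j k l x : U x ->
  curv G i j x k l + curv G j k x i l + curv G k i x j l = 0.
Proof.
move=> Ux.
have d a b c : mpd a (conn G b) x c l = mpd a (conn G c) x b l.
  rewrite [LHS]mxE [RHS]mxE; apply: near_eq_pd.
  by apply: filterS (metric_on_nbhs mG Ux) => y Uy; exact: (conn_sym mG Uy).
have c a b e : (conn G a x *m conn G b x) e l = (conn G e x *m conn G b x) a l.
  rewrite [LHS]mxE [RHS]mxE; apply: eq_bigr => s _.
  by rewrite (conn_sym mG Ux a e).
apply: etrans (congr2 +%R (congr2 +%R (curvE _ _ _ _ _ _) (curvE _ _ _ _ _ _))
  (curvE _ _ _ _ _ _)) _.
have alg (D P : 'I_m -> 'I_m -> 'I_m -> R) :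
    (forall a b c, D a b c = D a c b) -> (forall a b e, P a b e = P e b a) ->
    (D i j k - D j i k + P j i k - P i j k) +
    (D j k i - D k j i + P k j i - P j k i) +
    (D k i j - D i k j + P i k j - P k i j) = 0.
  by move=> sD sP; rewrite (sD i k j) (sD j i k) (sD k j i) (sP k j i) (sP j i k)
    (sP i k j); ring.
exact: (alg (fun a b c => mpd a (conn G b) x c l)
            (fun a b e => (conn G a x *m conn G b x) e l)).
Qed.
End OnU2.

End LeviCivita.

(** * The connection pulled back along a map *)

Section Pullback.
Context {R : realType} {q m : nat}.
Variables (V : set 'rV[R]_q) (W : set 'rV[R]_m).
Variables (H : 'rV[R]_m -> 'M[R]_m) (F : 'rV[R]_q -> 'rV[R]_m).
Hypotheses (oV : open V) (mH : metric_on W H) (sF : smooth_on V F).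
Hypothesis FW : forall x, V x -> W (F x).

(** The Jacobian matrix of [F], whose rows are the images of the coordinate
    fields; expressed with partial derivatives so that its entries are visibly
    smooth functions. *)
Definition frame x : 'M[R]_(q, m) := \matrix_(i, r) pd i (fun y => F y 0 r) x.

(** The connection form of the pullback by [F] of the Levi-Civita connection of
    [H]. *)
Definition omega i x : 'M[R]_m := \sum_r frame x i r *: conn H r (F x).

(** The rows of [A] are fields along [F]. *)
Definition nabla p i (A : 'rV[R]_q -> 'M[R]_(p, m)) x : 'M[R]_(p, m) :=
  mpd i A x + A x *m omega i x.

Definition smooth_mx p l (A : 'rV[R]_q -> 'M[R]_(p, l)) : Prop :=
  forall r s, smooth_fun V (fun x => A x r s).

Lemma smooth_mx_mdiff p l (A : 'rV[R]_q -> 'M[R]_(p, l)) x :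
  smooth_mx A -> V x -> mdiff A x.
Proof. by move=> sA Vx r s; exact: smooth_differentiable (sA r s) Vx. Qed.

Lemma smooth_mx_mdiff_mpd p l (A : 'rV[R]_q -> 'M[R]_(p, l)) i x :
  smooth_mx A -> V x -> mdiff (mpd i A) x.
Proof.
move=> sA Vx r s; rewrite (_ : (fun y => _) = pd i (fun y => A y r s)).
  by apply: smooth_differentiable Vx; exact: smooth_pd.
by apply/funext => y; rewrite [LHS]mxE.
Qed.

Lemma smooth_frame : smooth_mx frame.
Proof.
move=> i r; rewrite (_ : (fun y => _) = pd i (fun y => F y 0 r)).
  by apply: smooth_pd; exact: sF.
by apply/funext => y; rewrite [LHS]mxE.
Qed.

Section At.
Variable x : 'rV[R]_q.
Hypothesis Vx : V x.

Lemma V_nbhs : nbhs x V. Proof. exact: open_nbhs_nbhs. Qed.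

Lemma map_differentiable r : differentiable (fun y => F y 0 r) x.
Proof. exact: smooth_differentiable (sF r) Vx. Qed.

Lemma jacobian_frame : 'J F x = frame x.
Proof.
apply/matrixP => i r; rewrite [RHS]mxE; apply: jacobianE.
exact: map_differentiable.
Qed.

Lemma mdiff_comp p l (A : 'rV[R]_m -> 'M[R]_(p, l)) :
  mdiff A (F x) -> mdiff (fun y => A (F y)) x.
Proof.
move=> dA r s; apply: (differentiable_compf (f := fun z => A z r s)) => //.
exact: map_differentiable.
Qed.

Lemma mpd_comp p l i (A : 'rV[R]_m -> 'M[R]_(p, l)) : mdiff A (F x) ->
  mpd i (fun y => A (F y)) x = \sum_r frame x i r *: mpd r A (F x).
Proof.
move=> dA; apply/matrixP => a b; rewrite [LHS]mxE summxE.
rewrite (pd_comp (f := fun z => A z a b)) //; last exact: map_differentiable.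
rewrite jacobian_frame; apply: eq_bigr => r _; rewrite [RHS]mxE.
by congr (_ * _); rewrite [RHS]mxE.
Qed.

Lemma mdiff_conn_comp r : mdiff (fun y => conn H r (F y)) x.
Proof. by apply: mdiff_comp; apply: (mdiff_conn mH); exact: FW. Qed.

Lemma mdiff_omega i : mdiff (omega i) x.
Proof.
apply: mdiff_sum => r; apply: mdiffZ; last exact: mdiff_conn_comp.
exact: (smooth_mx_mdiff smooth_frame Vx).
Qed.

Lemma omega_compat i :
  mpd i (fun y => H (F y)) x = omega i x *m H (F x) + H (F x) *m (omega i x)^T.
Proof.
have Wx := FW Vx.
rewrite mpd_comp; last exact: (mdiff_metric mH).
rewrite /omega linear_sum /= mulmx_suml mulmx_sumr -big_split /=.
apply: eq_bigr => r _; rewrite (conn_compat mH Wx r) linearZ /=.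
by rewrite -scalemxAl -scalemxAr -scalerDr.
Qed.

Lemma pd_frame i j r : pd i (fun y => frame y j r) x = pd j (fun y => frame y i r) x.
Proof.
rewrite (@eq_pd _ _ _ (pd j (fun y => F y 0 r))); last by move=> y; rewrite [LHS]mxE.
rewrite [RHS](@eq_pd _ _ _ (pd i (fun y => F y 0 r))); last by move=> y; rewrite [LHS]mxE.
exact: (pd_comm _ _ oV).
Qed.

Lemma mpd_omega i j : mpd i (omega j) x =
  \sum_s (pd i (fun y => frame y j s) x *: conn H s (F x)
          + frame x j s *: \sum_r frame x i r *: mpd r (conn H s) (F x)).
Proof.
have df a s : differentiable (fun y => frame y a s) x.
  exact: (smooth_mx_mdiff smooth_frame Vx).
rewrite mpd_sum; last by move=> r; apply: mdiffZ => //; exact: mdiff_conn_comp.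
apply: eq_bigr => s _; rewrite mpdZ //; last exact: mdiff_conn_comp.
by rewrite mpd_comp //; apply: (mdiff_conn mH); exact: FW.
Qed.

Definition pullback_curv i j : 'M[R]_m :=
  mpd i (omega j) x - mpd j (omega i) x
  + omega j x *m omega i x - omega i x *m omega j x.

(** Naturality of curvature. By the chain rule the derivative of [omega] has a
    term with the second derivatives of [F], which is symmetric in the two
    directions and so drops out of the commutator. *)
Lemma pullback_curvE i j : pullback_curv i j =
  \sum_r \sum_s (frame x i r * frame x j s) *: curv H r s (F x).
Proof.
have prod a b : omega a x *m omega b x =
    \sum_r \sum_s (frame x a r * frame x b s) *: (conn H r (F x) *m conn H s (F x)).
  rewrite /omega mulmx_suml; apply: eq_bigr => r _.
  rewrite mulmx_sumr; apply: eq_bigr => s _.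
  by rewrite -scalemxAl -scalemxAr scalerA.
have dpart a b : mpd a (omega b) x =
   \sum_s pd a (fun y => frame y b s) x *: conn H s (F x)
   + \sum_r \sum_s (frame x a r * frame x b s) *: mpd r (conn H s) (F x).
  rewrite mpd_omega big_split /= [in RHS]exchange_big /=; congr (_ + _).
  apply: eq_bigr => s _; rewrite scaler_sumr; apply: eq_bigr => r _.
  by rewrite scalerA mulrC.
have dpart' : mpd j (omega i) x =
   \sum_s pd i (fun y => frame y j s) x *: conn H s (F x)
   + \sum_r \sum_s (frame x i r * frame x j s) *: mpd s (conn H r) (F x).
  apply: etrans (dpart _ _) (congr2 +%R _ _).
    by apply: eq_bigr => s _; rewrite (pd_frame i j).
  apply: etrans (exchange_big _ _ _ _ _ _) _ => /=.
  by apply: eq_bigr => r _; apply: eq_bigr => s _; rewrite mulrC.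
have prodji : omega j x *m omega i x =
    \sum_r \sum_s (frame x i r * frame x j s) *: (conn H s (F x) *m conn H r (F x)).
  apply: etrans (prod _ _) (etrans (exchange_big _ _ _ _ _ _) _) => /=.
  by apply: eq_bigr => r _; apply: eq_bigr => s _; rewrite mulrC.
rewrite /pullback_curv dpart dpart' prodji prod.
set P := \sum_s pd i _ x *: _.
have cancel (A B C D Z : 'M[R]_m) : Z + A - (Z + B) + C - D = A - B + C - D.
  by rewrite opprD addrACA subrr add0r.
rewrite cancel -!sumrB -!big_split -sumrB /=.
apply: eq_bigr => r _; rewrite -!sumrB -big_split -sumrB /=.
apply: eq_bigr => s _; rewrite curv_mx.
by rewrite -scalerBr -scalerDr -scalerBr.
Qed.

Lemma mdiff_metric_comp : mdiff (fun y => H (F y)) x.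
Proof. by apply: mdiff_comp; apply: (mdiff_metric mH); exact: FW. Qed.

Lemma nabla_compat p l (A : 'rV[R]_q -> 'M[R]_(p, m)) (B : 'rV[R]_q -> 'M[R]_(l, m)) i :
  mdiff A x -> mdiff B x ->
  mpd i (fun y => A y *m H (F y) *m (B y)^T) x =
  nabla i A x *m H (F x) *m (B x)^T + A x *m H (F x) *m (nabla i B x)^T.
Proof.
move=> dA dB; rewrite mpdM; [|apply: mdiffM => //; exact: mdiff_metric_comp|exact: mdiff_tr].
rewrite mpdM //; last exact: mdiff_metric_comp.
rewrite mpd_tr omega_compat /nabla.
move: (mpd i A x) (mpd i B x) (A x) (B x) (H (F x)) (omega i x) => dA' dB' a b h w.
by rewrite !(addmx_tr, trmx_mul) !(mulmxDl, mulmxDr) !mulmxA !addrA [LHS]addrAC.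
Qed.

Lemma mdiff_nabla p (A : 'rV[R]_q -> 'M[R]_(p, m)) i :
  smooth_mx A -> mdiff (nabla i A) x.
Proof.
move=> sA; apply: mdiffD; first exact: smooth_mx_mdiff_mpd.
by apply: mdiffM; [exact: smooth_mx_mdiff|exact: mdiff_omega].
Qed.

Lemma nabla_comm p (A : 'rV[R]_q -> 'M[R]_(p, m)) i j : smooth_mx A ->
  nabla i (nabla j A) x - nabla j (nabla i A) x = A x *m pullback_curv i j.
Proof.
move=> sA; have dA := smooth_mx_mdiff sA Vx.
have E a b : nabla a (nabla b A) x = mpd a (mpd b A) x +
    (mpd a A x *m omega b x + A x *m mpd a (omega b) x)
    + (mpd b A x + A x *m omega b x) *m omega a x.
  rewrite {1}/nabla mpdD.
  - by rewrite mpdM //; exact: mdiff_omega.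
  - exact: smooth_mx_mdiff_mpd.
  - by apply: mdiffM => //; exact: mdiff_omega.
have S : mpd i (mpd j A) x = mpd j (mpd i A) x.
  apply/matrixP => r s; rewrite [LHS]mxE [RHS]mxE.
  have e a b : pd a (fun y => mpd b A y r s) x = pd a (pd b (fun y => A y r s)) x.
    by apply: eq_pd => y; rewrite [LHS]mxE.
  by rewrite !e; exact: (pd_comm _ _ oV).
rewrite !E S /pullback_curv.
move: (mpd j (mpd i A) x) (mpd i A x) (mpd j A x) (A x) (mpd i (omega j) x)
  (mpd j (omega i) x) (omega i x) (omega j x).
move=> a b c d e f g h.
rewrite !(mulmxDr, mulmxDl, mulmxN) !mulmxA.
move: (d *m e) (d *m f) (b *m h) (d *m h *m g) (d *m g *m h) (c *m g).
move=> a1 a2 a3 a4 a5 a6.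
by apply/matrixP => r s; rewrite !(addmxE, oppmxE); ring.
Qed.

(** The pullback connection has no torsion either: second derivatives of [F]
    and the Christoffel symbols are both symmetric. *)
Lemma nabla_frame_sym i j : row j (nabla i frame x) = row i (nabla j frame x).
Proof.
have Wx := FW Vx.
have E a b s : nabla a frame x b s = pd a (fun y => frame y b s) x +
   \sum_t \sum_r frame x b t * (frame x a r * conn H r (F x) t s).
  rewrite [LHS]addmxE; congr (_ + _); first by rewrite [LHS]mxE.
  rewrite [LHS]mxE; apply: eq_bigr => t _; rewrite summxE mulr_sumr.
  by apply: eq_bigr => r _; congr (_ * _); rewrite [LHS]mxE.
apply/rowP => s; rewrite [LHS]mxE [RHS]mxE !E pd_frame; congr (_ + _).
rewrite exchange_big /=; apply: eq_bigr => r _; apply: eq_bigr => t _.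
by rewrite mulrCA (conn_sym mH Wx).
Qed.

(** Koszul's formula. The scalar products [C a j l] of the derivatives of the
    frame with the frame are symmetric in [a] and [j], and their symmetrisation
    in [j] and [l] is the derivative of the induced metric; these relations can
    be solved for [C]. *)
Lemma nabla_frame_tangential (U : set 'rV[R]_q) G i :
  metric_on U G -> U x ->
  (\near x, G x = frame x *m H (F x) *m (frame x)^T) ->
  nabla i frame x *m H (F x) *m (frame x)^T = christoffel1 G i x.
Proof.
move=> mG Ux nG.
pose C a : 'M[R]_q := nabla a frame x *m H (F x) *m (frame x)^T.
have df : mdiff frame x by exact: (smooth_mx_mdiff smooth_frame Vx).
have dG a j l : pd a (fun y => G y j l) x = C a j l + C a l j.
  have -> : pd a (fun y => G y j l) x = mpd a G x j l by rewrite [RHS]mxE.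
  rewrite (near_eq_mpd _ nG) nabla_compat // addmxE; congr (_ + _).
  rewrite [RHS](_ : _ = (C a)^T j l); last by rewrite [RHS]mxE.
  by rewrite /C !trmx_mul trmxK (metric_on_tr mH (FW Vx)) mulmxA.
have sC a b l : C a b l = C b a l.
  suff : row b (C a) = row a (C b) by move=> /rowP/(_ l); rewrite [LHS]mxE [RHS]mxE.
  by rewrite /C !row_mul nabla_frame_sym.
rewrite -/(C i); apply/matrixP => j l; rewrite [RHS]mxE !dG.
by rewrite (sC j i) (sC l i) (sC j l); field.
Qed.

End At.
End Pullback.

(** * The Gauss equation *)

Section HypersurfaceAlgebra.
Context {R : realType} {n : nat}.

(** A frame of a hyperplane completed by a unit normal is a basis, so the
    identity is the sum of the two orthogonal projections. *)
Lemma frame_completeness (h : 'M[R]_n.+1) (E : 'M[R]_(n, n.+1)) (v : 'rV[R]_n.+1) :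
  h^T = h -> E *m h *m E^T \in unitmx -> E *m h *m v^T = 0 ->
  v *m h *m v^T = 1%:M ->
  h *m (v^T *m v + E^T *m invmx (E *m h *m E^T) *m E) = 1%:M.
Proof.
move=> hT uG Ev vv; set G := E *m h *m E^T in uG *.
pose B : 'M[R]_(1 + n, n.+1) := col_mx v E.
pose D : 'M[R]_(1 + n) := block_mx 1%:M 0 0 (invmx G).
have vE : v *m h *m E^T = 0.
  by apply: trmx_inj; rewrite trmx0 -Ev !trmx_mul trmxK hT mulmxA.
have BB : B *m (h *m B^T *m D) = 1%:M.
  rewrite !mulmxA /B /D tr_col_mx mul_col_mx mul_col_row vv vE Ev -/G.
  rewrite mulmx_block !(mulmx0, mul0mx, addr0, add0r, mulmx1, mul1mx) mulmxV //.
  by rewrite -scalar_mx_block.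
have <- : h *m (B^T *m (D *m B)) = 1%:M.
  by rewrite !mulmxA; exact: (mulmx1C (A := (B : 'M[R]_n.+1)) BB).
rewrite -!mulmxA; congr (h *m _); rewrite /B /D tr_col_mx mul_block_col mul_row_col.
by rewrite !(mul0mx, addr0, add0r, mul1mx).
Qed.

(** The contraction of the Gauss equation. The constant curvature part
    contributes [n - 1] times the metric, since the identity has trace [n]. *)
Lemma ricci_trace (G B : 'M[R]_n) (c : R) (K : 'I_n -> 'I_n -> 'M[R]_n) :
  G \in unitmx -> G^T = G -> B^T = B ->
  (forall i j, K i j *m G = c *: (col j G *m row i G - col i G *m row j G)
       + (row j B)^T *m row i B - (row i B)^T *m row j B) ->
  \matrix_(j, k) (\sum_i K i j k i) =
    (c * (n%:R - 1)) *: G + \tr (B *m invmx G) *: B - B *m invmx G *m B.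
Proof.
move=> uG GT BT HK; apply/matrixP => j k; rewrite [LHS]mxE.
have rG i : row i G *m invmx G = row i 1%:M by rewrite -row_mul mulmxV.
have KE i : K i j = c *: (col j G *m row i 1%:M - col i G *m row j 1%:M)
   + (row j B)^T *m row i (B *m invmx G) - (row i B)^T *m row j (B *m invmx G).
  rewrite -[LHS](mulmxK uG) HK !(mulmxDl, mulNmx) -!scalemxAl mulmxBl.
  by rewrite -!mulmxA !rG !row_mul.
have ent (u : 'cV[R]_n) (v : 'rV[R]_n) a b : (u *m v) a b = u a 0 * v 0 b.
  by rewrite mxE big_ord1.
have KEkk i : K i j k i = c * (G k j - G k i * (j == i)%:R)
  + B j k * (B *m invmx G) i i - (B *m invmx G) j i * B i k.
  have colE (A : 'M[R]_n) a : (col a A) k 0 = A k a by rewrite mxE.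
  have rowE (A : 'M[R]_n) a b : (row a A) 0 b = A a b by rewrite mxE.
  have trE (A : 'M[R]_n) a : (row a A)^T k 0 = A a k by rewrite !mxE.
  rewrite KE !(addmxE, oppmxE) scalemxE !(addmxE, oppmxE) !ent !colE !rowE !trE.
  by rewrite ![1%:M _ _]mxE eqxx mulr1 [B i k * _]mulrC.
under eq_bigr do rewrite KEkk.
rewrite sumrB big_split /= -mulr_sumr -mulr_sumr sumrB sumr_const card_ord.
rewrite (bigD1 j) //= eqxx mulr1 big1 ?addr0; last first.
  by move=> i; rewrite eq_sym => /negbTE ->; rewrite mulr0.
rewrite !(addmxE, oppmxE) !scalemxE [(_ *m B) j k]mxE /mxtrace.
have -> : G j k = G k j by rewrite -[in LHS]GT mxE.
by rewrite -mulr_natr; ring.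
Qed.

End HypersurfaceAlgebra.

Section Gauss.
Context {R : realType} {n : nat}.
Variables (V : set 'rV[R]_n) (W : set 'rV[R]_n.+1).
Variables (H : 'rV[R]_n.+1 -> 'M[R]_n.+1) (F : 'rV[R]_n -> 'rV[R]_n.+1).
Variables (G : 'rV[R]_n -> 'M[R]_n) (v : 'rV[R]_n -> 'rV[R]_n.+1) (c : R).
Hypotheses (mG : metric_on V G) (mH : metric_on W H) (sF : smooth_on V F).
Hypotheses (sv : smooth_on V v) (FW : forall x, V x -> W (F x)).
Let E := frame F.
Hypothesis GE : forall x, V x -> G x = E x *m H (F x) *m (E x)^T.
Hypothesis Ev : forall x, V x -> E x *m H (F x) *m (v x)^T = 0.
Hypothesis vv : forall x, V x -> v x *m H (F x) *m (v x)^T = 1%:M.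
Let oV : open V. Proof. by case: mG. Qed.
Let nab p i (A : 'rV[R]_n -> 'M[R]_(p, n.+1)) x := nabla H F i A x.

(** The scalar products of the second derivatives of the immersion with the
    unit normal. *)
Definition second_form x : 'M[R]_n :=
  \matrix_(i, k) (nab i E x *m H (F x) *m (v x)^T) k 0.

Section At.
Variable x : 'rV[R]_n.
Hypothesis Vx : V x.

Let sE : smooth_mx V E := smooth_frame sF.
Let dE : mdiff E x := smooth_mx_mdiff sE Vx.
Let HT : (H (F x))^T = H (F x) := metric_on_tr mH (FW Vx).

Lemma mdiff_normal : mdiff v x.
Proof. by move=> r s; rewrite (ord1 r); exact: smooth_differentiable (sv s) Vx. Qed.

Lemma nab_tangential i : nab i E x *m H (F x) *m (E x)^T = conn G i x *m G x.
Proof.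
rewrite (conn_metric mG Vx); apply: (nabla_frame_tangential oV mH sF FW Vx _ mG Vx).
by apply: filterS (V_nbhs oV Vx) => y; exact: GE.
Qed.

Lemma nab_normal i : nab i E x *m H (F x) *m (v x)^T = (row i (second_form x))^T.
Proof. by apply/colP => k; rewrite 3![RHS]mxE. Qed.

Lemma second_form_tr : (second_form x)^T = second_form x.
Proof.
apply/matrixP => i k; rewrite [LHS]mxE [LHS]mxE [RHS]mxE.
have := nabla_frame_sym oV mH sF FW Vx i k.
have e a b : (nab a E x *m H (F x) *m (v x)^T) b 0 =
   (row b (nab a E x) *m H (F x) *m (v x)^T) 0 0.
  by rewrite -!row_mul [RHS]mxE.
by rewrite !e => ->.
Qed.

Lemma completeness p l (X : 'M[R]_(p, n.+1)) (Y : 'M[R]_(l, n.+1)) :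
  X *m H (F x) *m Y^T =
    (X *m H (F x) *m (E x)^T) *m invmx (G x) *m (Y *m H (F x) *m (E x)^T)^T
    + (X *m H (F x) *m (v x)^T) *m (Y *m H (F x) *m (v x)^T)^T.
Proof.
have uG : E x *m H (F x) *m (E x)^T \in unitmx.
  by rewrite -(GE Vx); exact: (metric_on_unit mG).
have C := frame_completeness HT uG (Ev Vx) (vv Vx).
rewrite -(GE Vx) in C; move: C HT.
move: (H (F x)) (E x) (v x) (invmx (G x)) => h e w g C hT.
rewrite !trmx_mul !trmxK hT.
have -> : X *m h *m Y^T = X *m (h *m (w^T *m w + e^T *m g *m e)) *m (h *m Y^T).
  by rewrite C mulmx1 mulmxA.
by rewrite !mulmxDr !mulmxDl !mulmxA addrC.
Qed.

End At.

Section At2.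
Variable x : 'rV[R]_n.
Hypothesis Vx : V x.

Let sE : smooth_mx V E := smooth_frame sF.
Let dE : mdiff E x := smooth_mx_mdiff sE Vx.

(** Differentiating the Koszul formula: the scalar product of two first
    derivatives of the frame is split by [completeness] into a part intrinsic to
    [G] and a product of second fundamental forms. *)
Lemma mpd_tangential i j :
  nab i (nab j E) x *m H (F x) *m (E x)^T =
  mpd i (conn G j) x *m G x + conn G j x *m conn G i x *m G x
  - (row j (second_form x))^T *m row i (second_form x).
Proof.
have ->: nab i (nab j E) x *m H (F x) *m (E x)^T =
    mpd i (fun y => nab j E y *m H (F y) *m (E y)^T) x
    - nab j E x *m H (F x) *m (nab i E x)^T.
  apply/eqP; rewrite eq_sym subr_eq; apply/eqP.
  apply: (nabla_compat mH sF FW Vx); last exact: dE.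
  exact: (mdiff_nabla mH sF FW Vx).
rewrite (@near_eq_mpd _ _ _ _ _ _ (fun y => conn G j y *m G y)); last first.
  by apply: filterS (V_nbhs oV Vx) => y Vy; exact: (nab_tangential Vy).
rewrite mpdM; [|exact: (mdiff_conn mG)|exact: (mdiff_metric mG)].
rewrite (conn_compat mG Vx i) (completeness Vx (nab j E x)) !(nab_tangential Vx) !nab_normal.
rewrite trmxK trmx_mul (metric_on_tr mG Vx) mulmxK ?(metric_on_unit mG Vx) //.
move: (mpd i _ x) (conn G i x) (conn G j x) (G x) (_ *m row i _) => A P Q g S.
by rewrite mulmxDr !mulmxA opprD !addrA addrK.
Qed.

(** The Gauss equation for an arbitrary ambient metric: antisymmetrising
    [mpd_tangential] produces the curvature of [G] on one side and, by
    [nabla_comm], the ambient curvature on the other. *)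
Lemma gauss_equation i j :
  curv G i j x *m G x =
  E x *m (pullback_curv H F x i j *m H (F x)) *m (E x)^T
  + (row j (second_form x))^T *m row i (second_form x)
  - (row i (second_form x))^T *m row j (second_form x).
Proof.
rewrite curv_mx (mulmxA (E x)) -(nabla_comm oV mH sF FW Vx) // !mulmxBl.
rewrite -/(nab j E) -/(nab i E) -/(nab i (nab j E) x) -/(nab j (nab i E) x).
rewrite !mpd_tangential.
move: (mpd i _ x) (mpd j _ x) (conn G i x) (conn G j x) (G x) => A B P Q g.
move: (_ *m row i _) (_ *m row j _) => S T.
rewrite !(mulmxDl, mulNmx).
move: (A *m g) (B *m g) (P *m Q *m g) (Q *m P *m g) => a b p q.
by apply/matrixP => r s; rewrite !(addmxE, oppmxE); ring.
Qed.

(** The curvature tensor of a space of constant curvature [c]. *)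
Definition has_curvature y : Prop := forall r s, curv H r s y *m H y =
  c *: (col s (H y) *m row r (H y) - col r (H y) *m row s (H y)).

Lemma pullback_curv_space_form i j : has_curvature (F x) ->
  E x *m (pullback_curv H F x i j *m H (F x)) *m (E x)^T =
  c *: (col j (G x) *m row i (G x) - col i (G x) *m row j (G x)).
Proof.
move=> HC.
have colG k : col k (G x) = E x *m (H (F x) *m (row k (E x))^T).
  by rewrite (GE Vx) -mulmxA colE -!mulmxA -colE tr_row.
have rowG k : row k (G x) = row k (E x) *m H (F x) *m (E x)^T.
  by rewrite (GE Vx) !row_mul.
rewrite !colG !rowG (pullback_curvE oV mH sF FW Vx) mulmx_suml.
have colS k : H (F x) *m (row k (E x))^T = \sum_s E x k s *: col s (H (F x)).
  apply/matrixP => a b; rewrite mxE summxE; apply: eq_bigr => s _.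
  by rewrite !mxE mulrC.
have rowS k : row k (E x) *m H (F x) = \sum_s E x k s *: row s (H (F x)).
  apply/matrixP => a b; rewrite mxE summxE; apply: eq_bigr => s _.
  by rewrite !mxE.
have -> : \sum_r (\sum_s (frame F x i r * frame F x j s) *: curv H r s (F x)) *m H (F x)
  = c *: (H (F x) *m (row j (E x))^T *m (row i (E x) *m H (F x))
         - H (F x) *m (row i (E x))^T *m (row j (E x) *m H (F x))).
  rewrite !colS !rowS.
  have prod a b : (\sum_s E x a s *: col s (H (F x))) *m (\sum_s E x b s *: row s (H (F x)))
    = \sum_r \sum_s (E x b r * E x a s) *: (col s (H (F x)) *m row r (H (F x))).
    rewrite mulmx_sumr; apply: eq_bigr => r _; rewrite mulmx_suml.
    by apply: eq_bigr => s _; rewrite -scalemxAl -scalemxAr scalerA mulrC.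
  rewrite (prod j i) (prod i j) [X in _ - X]exchange_big /=.
  rewrite -sumrB scaler_sumr; apply: eq_bigr => r _.
  rewrite -sumrB scaler_sumr mulmx_suml; apply: eq_bigr => s _.
  rewrite -scalemxAl HC (mulrC (E x j s)) -scalerBr !scalerA; congr (_ *: _).
  exact: mulrC.
by rewrite -scalemxAr -scalemxAl mulmxBr mulmxBl !mulmxA.
Qed.

(** This identity ties the intrinsic to the extrinsic geometry: the Ricci
    operator is a quadratic polynomial in the shape operator [A], with the trace
    of [A] as its only further coefficient. *)
Lemma ricci_op_gauss : has_curvature (F x) ->
  let A := second_form x *m invmx (G x) in
  ricci_op G x = (c * (n%:R - 1))%:M + \tr A *: A - A *m A.
Proof.
move=> HC A; have uG := metric_on_unit mG Vx.
have RE : ricci G x = \matrix_(j, k) (\sum_i curv G i j x k i).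
  apply/matrixP => j k; rewrite [LHS]mxE [RHS]mxE.
  by apply: eq_bigr => i _; rewrite curv_riemann.
rewrite /ricci_op RE (ricci_trace (c := c) (B := second_form x) uG
  (metric_on_tr mG Vx) (second_form_tr Vx)).
  rewrite !mulmxDl mulNmx -!scalemxAl mulmxV // scalemx1.
  by rewrite /A !mulmxA.
by move=> i j; rewrite gauss_equation (pullback_curv_space_form i j HC).
Qed.

End At2.
End Gauss.

(** * Constant sectional curvature *)

Section AlgebraicCurvature.
Context {R : realType} {m : nat}.
Implicit Types (T : 'I_m -> 'I_m -> 'M[R]_m) (u v w z : 'rV[R]_m).

(** The covariant curvature tensor on arbitrary vectors, for [T i j] the matrix
    of the curvature along [e_i] and [e_j] with both indices lowered. *)
Definition curv_form T u v w z : R :=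
  \sum_i \sum_j u 0 i * v 0 j * bilin (T i j) w z.

Lemma bilinDl (A : 'M[R]_m) u v w : bilin A (u + v) w = bilin A u w + bilin A v w.
Proof. by rewrite /bilin !mulmxDl mxE. Qed.

Lemma bilinDr (A : 'M[R]_m) u v w : bilin A u (v + w) = bilin A u v + bilin A u w.
Proof. by rewrite /bilin addmx_tr mulmxDr mxE. Qed.

Lemma bilinZl (A : 'M[R]_m) a u v : bilin A (a *: u) v = a * bilin A u v.
Proof. by rewrite /bilin -!scalemxAl mxE. Qed.

Lemma bilinZr (A : 'M[R]_m) a u v : bilin A u (a *: v) = a * bilin A u v.
Proof. by rewrite /bilin linearZ /= -scalemxAr mxE. Qed.

Lemma bilin_delta (A : 'M[R]_m) i j :
  bilin A (delta_mx 0 i) (delta_mx 0 j) = A i j.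
Proof. by rewrite /bilin -rowE trmx_delta -colE !mxE. Qed.

Section Form.
Variable T : 'I_m -> 'I_m -> 'M[R]_m.
Let D := curv_form T.

Lemma curv_formD1 u u' v w z : D (u + u') v w z = D u v w z + D u' v w z.
Proof.
rewrite /D /curv_form -big_split; apply: eq_bigr => i _ /=.
by rewrite -big_split; apply: eq_bigr => j _ /=; rewrite mxE !mulrDl.
Qed.

Lemma curv_formD2 u v v' w z : D u (v + v') w z = D u v w z + D u v' w z.
Proof.
rewrite /D /curv_form -big_split; apply: eq_bigr => i _ /=.
by rewrite -big_split; apply: eq_bigr => j _ /=; rewrite mxE mulrDr mulrDl.
Qed.

Lemma curv_formD3 u v w w' z : D u v (w + w') z = D u v w z + D u v w' z.
Proof.
rewrite /D /curv_form -big_split; apply: eq_bigr => i _ /=.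
by rewrite -big_split; apply: eq_bigr => j _ /=; rewrite bilinDl mulrDr.
Qed.

Lemma curv_formD4 u v w z z' : D u v w (z + z') = D u v w z + D u v w z'.
Proof.
rewrite /D /curv_form -big_split; apply: eq_bigr => i _ /=.
by rewrite -big_split; apply: eq_bigr => j _ /=; rewrite bilinDr mulrDr.
Qed.

Lemma curv_form_delta i j k l :
  D (delta_mx 0 i) (delta_mx 0 j) (delta_mx 0 k) (delta_mx 0 l) = T i j k l.
Proof.
rewrite /D /curv_form (bigD1 i) //= [X in _ + X]big1 ?addr0; last first.
  move=> i' ne; apply: big1 => j' _; rewrite mxE eqxx (negbTE ne) /=.
  by rewrite !mul0r.
rewrite (bigD1 j) //= [X in _ + X]big1 ?addr0; last first.
  move=> j' ne; rewrite !mxE !eqxx (negbTE ne) /=.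
  by rewrite mulr0 mul0r.
by rewrite !mxE !eqxx !mul1r bilin_delta.
Qed.

Hypothesis antisym : forall i j, T j i = - T i j.

Lemma curv_form_alt u v w z : D v u w z = - D u v w z.
Proof.
rewrite /D /curv_form exchange_big -sumrN; apply: eq_bigr => i _ /=.
rewrite -sumrN; apply: eq_bigr => j _; rewrite antisym /bilin mulmxN mulNmx.
by rewrite oppmxE mulrN (mulrC (v 0 j)).
Qed.

Lemma curv_form_diag u w z : D u u w z = 0.
Proof. by have := curv_form_alt u u w z; lra. Qed.

Lemma curv_formZ1 a u v w z : D (a *: u) v w z = a * D u v w z.
Proof.
rewrite /D /curv_form mulr_sumr; apply: eq_bigr => i _.
by rewrite mulr_sumr; apply: eq_bigr => j _; rewrite mxE !mulrA.
Qed.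

Lemma curv_form_dependent u v w z : ~~ row_free (col_mx u v) -> D u v w z = 0.
Proof.
rewrite -kermx_eq0 => /rowV0Pn[x /sub_kermxP xuv x0].
rewrite -(hsubmxK x) mul_row_col in xuv x0.
rewrite [lsubmx x]mx11_scalar [rsubmx x]mx11_scalar !mul_scalar_mx in xuv x0.
move: (lsubmx x 0 0) (rsubmx x 0 0) xuv x0 => a b xuv x0.
have E1 : a * D u v w z = 0.
  rewrite -curv_formZ1 (_ : a *: u = (- b) *: v).
    by rewrite curv_formZ1 curv_form_diag mulr0.
  by apply/eqP; rewrite scaleNr -addr_eq0 xuv.
have E2 : b * D u v w z = 0.
  rewrite -[D _ _ _ _]opprK -curv_form_alt mulrN -curv_formZ1.
  rewrite (_ : b *: v = (- a) *: u).
    by rewrite curv_formZ1 curv_form_diag mulr0 oppr0.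
  by apply/eqP; rewrite scaleNr -addr_eq0 addrC xuv.
have [a0|/mulfI aI] := eqVneq a 0; last by apply: aI; rewrite E1 mulr0.
have [b0|/mulfI bI] := eqVneq b 0; last by apply: bI; rewrite E2 mulr0.
by case/eqP: x0; rewrite a0 b0 !raddf0 row_mx0.
Qed.

Hypothesis skew : forall i j, (T i j)^T = - T i j.
Hypothesis bianchi : forall i j k l, T i j k l + T j k i l + T k i j l = 0.
Hypothesis flat : forall u v, D u v v u = 0.

(** Polarising the biquadratic form [D u v v u] shows that exchanging the second
    and third arguments changes the sign; together with the given antisymmetries
    this makes [T] totally antisymmetric, and the Bianchi identity then reads
    [3 * T = 0]. *)
Lemma curv_form_flat i j k l : T i j k l = 0.
Proof.
have a1 a b p q : T b a p q = - T a b p q by rewrite antisym oppmxE.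
have a2 a b p q : T a b q p = - T a b p q.
  by rewrite -oppmxE -skew mxE.
(* Pair symmetry, from four instances of the Bianchi identity. *)
have pair a b p q : T a b p q = T p q a b.
  have B1 := bianchi a b p q; have B2 := bianchi b p q a.
  have B3 := bianchi p q a b; have B4 := bianchi q a b p.
  have e1 := a2 b p a q; have e2 := a2 p q a b; have e3 := a1 a p b q.
  have e4 := a1 b q p a; have e5 := a2 b q a p; have e6 := a1 a q p b.
  have e7 := a2 a q b p; have e8 := a2 a p b q; have e9 := a1 a q b p.
  have e10 := a2 a b p q; lra.
have d (u v : 'I_m) := flat (delta_mx 0 u) (delta_mx 0 v).
have s1 a p q : T a p q a + T a q p a = 0.
  have := flat (delta_mx 0 a) (delta_mx 0 p + delta_mx 0 q).
  have := d a p; have := d a q.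
  by rewrite !(curv_formD2, curv_formD3) !curv_form_delta; lra.
have s2 a b p q : T a p q b + T a q p b + T b p q a + T b q p a = 0.
  have := flat (delta_mx 0 a + delta_mx 0 b) (delta_mx 0 p + delta_mx 0 q).
  have := s1 a p q; have := s1 b p q.
  have := flat (delta_mx 0 a + delta_mx 0 b) (delta_mx 0 p).
  have := flat (delta_mx 0 a + delta_mx 0 b) (delta_mx 0 q).
  have := d a p; have := d a q; have := d b p; have := d b q.
  by rewrite !(curv_formD1, curv_formD2, curv_formD3, curv_formD4) !curv_form_delta; lra.
have sw a b p q : T a b p q = - T a p b q.
  have := s2 a q b p; have := pair q b p a; have := pair q p b a.
  have := a1 a p q b; have := a2 a p b q; have := a1 a b q p; have := a2 a b p q.
  lra.
have := bianchi i j k l; have := sw i j k l; have := sw j k i l.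
have := a1 i j k l; have := a1 i k j l; lra.
Qed.

End Form.

Lemma bilinC (A : 'M[R]_m) u v : A^T = A -> bilin A u v = bilin A v u.
Proof.
move=> AT; rewrite /bilin -[in LHS]AT -[in RHS](trmxK (v *m A *m u^T)) [in RHS]mxE.
by rewrite !trmx_mul trmxK mulmxA.
Qed.

(** The strict Cauchy-Schwarz inequality, from positivity on the component [w]
    of [v] orthogonal to [u], scaled to avoid a division. *)
Lemma gram_det_neq0 (h : 'M[R]_m) u v : h^T = h ->
  (forall w, w != 0 -> 0 < bilin h w w) -> row_free (col_mx u v) ->
  bilin h u u * bilin h v v - bilin h u v ^+ 2 != 0.
Proof.
move=> hT hp fuv; apply/eqP => N0.
have indep (a b : R) : a *: u + b *: v = 0 -> a = 0 /\ b = 0.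
  move=> ab; have E : row_mx a%:M b%:M *m col_mx u v = 0.
    by rewrite mul_row_col !mul_scalar_mx.
  have /eq_row_mx[a0 b0] : row_mx a%:M b%:M = row_mx 0 0 :> 'rV[R]_(1 + 1).
    by apply: (row_free_inj fuv); rewrite E row_mx0 mul0mx.
  move/matrixP: a0 => /(_ 0 0); move/matrixP: b0 => /(_ 0 0).
  by rewrite !mxE eqxx !mulr1n.
have u0 : u != 0.
  apply/eqP => u0; have [] := indep 1 0; last by move/eqP; rewrite oner_eq0.
  by rewrite u0 scaler0 scale0r addr0.
have hu := hp _ u0.
pose w := bilin h u u *: v + (- bilin h u v) *: u.
have ww : bilin h w w = bilin h u u * (bilin h u u * bilin h v v - bilin h u v ^+ 2).
  by rewrite /w !(bilinDl, bilinDr, bilinZl, bilinZr) (bilinC v u hT); ring.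
have [w0|/hp] := eqVneq w 0; last by rewrite ww N0 mulr0 ltxx.
by have [_ h0] := indep (- bilin h u v) (bilin h u u) (etrans (addrC _ _) w0);
   move: hu; rewrite h0 ltxx.
Qed.

End AlgebraicCurvature.

Section ConstantSectionalCurvature.
Context {R : realType} {m : nat}.
Variables (W : set 'rV[R]_m) (H : 'rV[R]_m -> 'M[R]_m) (c : R) (y : 'rV[R]_m).
Hypotheses (mH : metric_on W H) (Wy : W y).

Lemma curv_form_curvature_op u v w z :
  curv_form (fun i j => curv H i j y *m H y) u v w z =
  bilin (H y) (curvature_op H y u v w) z.
Proof.
have -> : curvature_op H y u v w = \sum_i \sum_j (u 0 i * v 0 j) *: (w *m curv H i j y).
  apply/rowP => l; rewrite [LHS]mxE summxE; apply: eq_bigr => i _.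
  rewrite summxE; apply: eq_bigr => j _; rewrite [RHS]mxE [in RHS]mxE mulr_sumr.
  by apply: eq_bigr => k _; rewrite curv_riemann mulrA.
rewrite /bilin !mulmx_suml summxE; apply: eq_bigr => i _.
rewrite !mulmx_suml summxE; apply: eq_bigr => j _.
by rewrite -!scalemxAl [RHS]mxE /bilin mulmxA.
Qed.

Let S i j : 'M[R]_m := col j (H y) *m row i (H y) - col i (H y) *m row j (H y).

Let SE i j k l : S i j k l = H y k j * H y i l - H y k i * H y j l.
Proof.
have e (A B : 'M[R]_m) a b : (col a A *m row b B) k l = A k a * B b l.
  by rewrite mxE big_ord1 !mxE.
by rewrite addmxE oppmxE !e.
Qed.

Lemma curv_form_space_form u v w z : curv_form S u v w z =
  bilin (H y) w v * bilin (H y) u z - bilin (H y) w u * bilin (H y) v z.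
Proof.
have E i j : bilin (S i j) w z = (w *m col j (H y)) 0 0 * (row i (H y) *m z^T) 0 0 -
   (w *m col i (H y)) 0 0 * (row j (H y) *m z^T) 0 0.
  rewrite /bilin /S mulmxBr mulmxBl addmxE oppmxE !mulmxA.
  by rewrite -2!(mulmxA (w *m _)) !(mxE, big_ord1).
have ex1 (a b : 'rV[R]_m) : bilin (H y) a b = \sum_j b 0 j * (a *m col j (H y)) 0 0.
  rewrite /bilin mxE; apply: eq_bigr => j _.
  by rewrite [X in _ * X]mxE mulrC colE mulmxA -colE [in RHS]mxE.
have ex2 (a b : 'rV[R]_m) : bilin (H y) a b = \sum_j a 0 j * (row j (H y) *m b^T) 0 0.
  rewrite /bilin -mulmxA mxE; apply: eq_bigr => j _.
  by rewrite -row_mul [in RHS]mxE.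
rewrite (ex1 w v) (ex2 u z) (ex1 w u) (ex2 v z) [X in _ = X - _]mulrC !mulr_suml.
rewrite /curv_form -sumrB; apply: eq_bigr => i _.
rewrite !mulr_sumr -sumrB; apply: eq_bigr => j _; rewrite E.
move: (w *m col j _) (w *m col i _) (row i _ *m _) (row j _ *m _) => a b p q.
ring.
Qed.

(** The difference of the curvature with its constant curvature model has all
    the symmetries of a curvature tensor, and vanishes on every plane: by
    hypothesis when the two vectors are independent, by antisymmetry when they
    are not. *)
Lemma constant_sectional_has_curvature :
  (forall u v, row_free (col_mx u v) -> sectional H y u v = c) ->
  forall r s, curv H r s y *m H y =
    c *: (col s (H y) *m row r (H y) - col r (H y) *m row s (H y)).
Proof.
move=> Hsec r s; pose T i j := curv H i j y *m H y - c *: S i j.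
have HT := metric_on_tr mH Wy.
have hs a b : H y a b = H y b a by rewrite -[in LHS]HT mxE.
have TE i j k l : T i j k l =
    (curv H i j y *m H y) k l - c * (H y k j * H y i l - H y k i * H y j l).
  by rewrite /T addmxE oppmxE scalemxE SE.
suff T0 : T r s = 0 by apply/eqP; rewrite -subr_eq0; apply/eqP.
have anti i j : T j i = - T i j.
  apply/matrixP => a b; rewrite oppmxE !TE (curv_antisym H i j) mulNmx oppmxE.
  ring.
apply/matrixP => k l; rewrite [RHS]mxE; apply: (curv_form_flat (T := T)) => //.
- move=> i j; apply/matrixP => a b; rewrite [LHS]mxE oppmxE !TE.
  have := congr1 (fun M : 'M[R]_m => M a b) (curv_skew mH i j Wy).
  rewrite [LHS]mxE oppmxE => ->.
  by rewrite (hs b j) (hs i a) (hs b i) (hs j a); ring.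
- move=> i j a b; rewrite !TE.
  have B : (curv H i j y *m H y) a b + (curv H j a y *m H y) i b +
      (curv H a i y *m H y) j b = 0.
    rewrite [X in X + _ + _]mxE [X in _ + X + _]mxE [X in _ + _ + X]mxE.
    rewrite -!big_split big1 //= => t _.
    by rewrite -!mulrDl (curv_bianchi mH i j a t Wy) mul0r.
  rewrite (hs j i) (hs a i) (hs a j); apply: etrans B.
  move: ((curv H i j y *m H y) a b) ((curv H j a y *m H y) i b)
        ((curv H a i y *m H y) j b) (H y) => p q t h.
  ring.
move=> u v.
have TD w z u' v' : curv_form T u' v' w z =
   bilin (H y) (curvature_op H y u' v' w) z - c * curv_form S u' v' w z.
  rewrite -curv_form_curvature_op /curv_form mulr_sumr -sumrB; apply: eq_bigr => i _.
  rewrite mulr_sumr -sumrB; apply: eq_bigr => j _.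
  rewrite /T /bilin mulmxBr mulmxBl addmxE oppmxE -scalemxAr -scalemxAl.
  by rewrite scalemxE; ring.
have [fuv|nf] := boolP (row_free (col_mx u v)); last first.
  exact: curv_form_dependent nf.
rewrite TD curv_form_space_form.
have Hpos w : w != 0 -> 0 < bilin (H y) w w.
  by case: mH => _ _ p _; exact: p.
have := Hsec u v fuv; rewrite /sectional => <-.
rewrite (bilinC v u HT).
have N0 := gram_det_neq0 HT Hpos fuv.
move: (bilin _ (curvature_op _ _ _ _ _) _) (bilin _ u u) (bilin _ v v) (bilin _ u v) N0.
by move=> p a b d N0; field; rewrite expr2 in N0.
Qed.

End ConstantSectionalCurvature.

(** * Characteristic polynomials of shape operators *)

Section Spectrum.
Context {R : realType} {n : nat}.
Implicit Types (A S G : 'M[R]_n).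

(** Here [a + ib] is an eigenvector, over the complex numbers, of
    [S *m invmx G] for the eigenvalue [x + iy]. Computing [bilin S a b] from
    either equation shows that [y] times the sum of the squared norms of [a] and
    [b] vanishes. *)
Lemma selfadjoint_real_eigenvalue S G (a b : 'rV[R]_n) (x y : R) :
  S^T = S -> G^T = G -> (forall v, v != 0 -> 0 < bilin G v v) ->
  a *m S = (x *: a - y *: b) *m G -> b *m S = (y *: a + x *: b) *m G ->
  (a != 0) || (b != 0) -> y = 0.
Proof.
move=> ST GT Gpos aS bS ab.
have SC := bilinC a b ST.
have E1 : bilin S a b = x * bilin G a b - y * bilin G b b.
  by rewrite {1}/bilin aS -/(bilin G _ _) bilinDl -scaleNr !bilinZl mulNr.
have E2 : bilin S b a = y * bilin G a a + x * bilin G a b.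
  by rewrite {1}/bilin bS -/(bilin G _ _) bilinDl !bilinZl (bilinC b a GT).
have nn v : 0 <= bilin G v v.
  have [->|/Gpos/ltW //] := eqVneq v 0.
  by rewrite /bilin !mul0mx mxE.
have E : y * (bilin G a a + bilin G b b) = 0 by rewrite E1 E2 in SC; lra.
move/eqP: E; rewrite mulf_eq0 => /orP[/eqP //|/eqP E].
by case/orP: ab => /Gpos; have := nn a; have := nn b; lra.
Qed.

(** The characteristic polynomial splits over the complex numbers, with real
    roots by the previous lemma. *)
Lemma char_poly_selfadjoint S G :
  S^T = S -> G^T = G -> (forall v, v != 0 -> 0 < bilin G v v) ->
  exists l : seq R, char_poly (S *m invmx G) = \prod_(z <- l) ('X - z%:P).
Proof.
move=> ST GT Gpos; set A := S *m invmx G.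
have uG : G \in unitmx by exact: posdef_unit.
have AG : A *m G = S by rewrite mulmxKV.
pose f := real_complex R.
pose Ac := map_mx f A.
have [r Hr] := closed_field_poly_normal (char_poly Ac).
rewrite (monicP (char_poly_monic Ac)) scale1r in Hr.
have realr z : z \in r -> z = f (complex.Re z).
  move=> zr; have : root (char_poly Ac) z by rewrite Hr root_prod_XsubC.
  rewrite -eigenvalue_root_char => /eigenvalueP[v vA v0].
  pose a : 'rV[R]_n := map_mx (@complex.Re R) v.
  pose b : 'rV[R]_n := map_mx (@complex.Im R) v.
  have ReM (w : 'rV[R[i]]_n) : map_mx (@complex.Re R) (w *m Ac) =
      map_mx (@complex.Re R) w *m A.
    apply/rowP => j; rewrite !mxE (big_morph (@complex.Re R) (id1 := 0) (op1 := +%R)) //.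
      by apply: eq_bigr => k _; rewrite !mxE; case: (w 0 k) => p q /=; rewrite mulr0 subr0.
    by case=> ? ? [].
  have ImM (w : 'rV[R[i]]_n) : map_mx (@complex.Im R) (w *m Ac) =
      map_mx (@complex.Im R) w *m A.
    apply/rowP => j; rewrite !mxE (big_morph (@complex.Im R) (id1 := 0) (op1 := +%R)) //.
      by apply: eq_bigr => k _; rewrite !mxE; case: (w 0 k) => p q /=; rewrite mulr0 add0r.
    by case=> ? ? [].
  have aA : a *m A = complex.Re z *: a - complex.Im z *: b.
    rewrite -ReM vA; apply/rowP => j; rewrite !mxE.
    by case: (z) => ? ?; case: (v 0 j).
  have bA : b *m A = complex.Im z *: a + complex.Re z *: b.
    rewrite -ImM vA; apply/rowP => j; rewrite !mxE.
    by case: (z) => ? ?; case: (v 0 j) => * /=; rewrite addrC.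
  have ab : (a != 0) || (b != 0).
    rewrite -negb_and; apply/andP => -[/eqP a0 /eqP b0]; case/eqP: v0.
    apply/rowP => j; move/rowP: a0 => /(_ j); move/rowP: b0 => /(_ j).
    by rewrite !mxE; case: (v 0 j) => p q /= -> ->.
  have Im0 : complex.Im z = 0.
    apply: (@selfadjoint_real_eigenvalue S G a b (complex.Re z)) => //.
      by rewrite -aA -mulmxA AG.
    by rewrite -bA -mulmxA AG.
  by move: Im0; case: (z) => p q /= ->.
exists [seq complex.Re z | z <- r]; apply: (map_poly_inj f).
rewrite map_char_poly Hr rmorph_prod /= big_map big_seq [RHS]big_seq.
by apply: eq_bigr => z /realr {1}->; rewrite map_polyXsubC.
Qed.

(** The real solutions of the quadratic equations relating a principal
    curvature to a Ricci eigenvalue. *)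
Definition quadratic_roots (k t : R) (s : seq R) : seq R :=
  flatten [seq [:: t / 2 + Num.sqrt (t ^+ 2 / 4 - (r - k));
                   t / 2 - Num.sqrt (t ^+ 2 / 4 - (r - k))] | r <- s].

Lemma mem_quadratic_roots k t s x :
  k + t * x - x ^+ 2 \in s -> x \in quadratic_roots k t s.
Proof.
move=> xs; apply/flattenP; eexists; first by apply/mapP; exists (k + t * x - x ^+ 2).
have -> : t ^+ 2 / 4 - (k + t * x - x ^+ 2 - k) = (x - t / 2) ^+ 2 by field.
rewrite sqrtr_sqr !inE; have [h|h] := ger0P (x - t / 2).
  by apply/orP; left; apply/eqP; ring.
by apply/orP; right; apply/eqP; ring.
Qed.

Fixpoint split_polys (N : nat) (cand : seq R) : seq {poly R} :=
  if N is N'.+1 then [seq ('X - x%:P) * p | x <- cand, p <- split_polys N' cand]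
  else [:: 1].

Lemma mem_split_polys cand l : {subset l <= cand} ->
  \prod_(z <- l) ('X - z%:P) \in split_polys (size l) cand.
Proof.
elim: l => [|x l IH] sl /=; first by rewrite big_nil inE.
rewrite big_cons; apply/allpairsP; exists (x, \prod_(z <- l) ('X - z%:P)) => /=.
split=> //; first by apply: sl; rewrite mem_head.
by apply: IH => z zl; apply: sl; rewrite inE zl orbT.
Qed.

(** An eigenvector of [A] for [x] is an eigenvector of the quadratic polynomial
    in [A] for [k + t * x - x ^+ 2]; so [x] solves one of finitely many quadratic
    equations, and only finitely many characteristic polynomials are possible. *)
Lemma char_poly_finite A (k t : R) (s l : seq R) :
  char_poly A = \prod_(z <- l) ('X - z%:P) ->
  char_poly (k%:M + t *: A - A *m A) = \prod_(z <- s) ('X - z%:P) ->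
  char_poly A \in split_polys n (quadratic_roots k t s).
Proof.
move=> Hl Hs; have sz : size l = n.
  by have := size_char_poly A; rewrite Hl size_prod_XsubC => -[].
rewrite Hl -{1}sz; apply: mem_split_polys => x xl; apply: mem_quadratic_roots.
have : root (char_poly A) x by rewrite Hl root_prod_XsubC.
rewrite -eigenvalue_root_char => /eigenvalueP[v vA v0].
rewrite -root_prod_XsubC -Hs -eigenvalue_root_char; apply/eigenvalueP; exists v => //.
rewrite mulmxBr mulmxDr mul_mx_scalar -scalemxAr mulmxA vA -scalemxAl vA !scalerA.
by rewrite -scalerDl -scalerBl expr2.
Qed.

Lemma char_poly_conj (A P : 'M[R]_n) : P \in unitmx ->
  char_poly (P *m A *m invmx P) = char_poly A.
Proof.
move=> uP; rewrite /char_poly.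
have -> : char_poly_mx (P *m A *m invmx P) =
    map_mx polyC P *m char_poly_mx A *m map_mx polyC (invmx P).
  rewrite /char_poly_mx mulmxBr mulmxBl !map_mxM; congr (_ - _).
  rewrite mul_mx_scalar -scalemxAl -map_mxM mulmxV // map_mx1.
  by rewrite scalemx1.
rewrite !det_mulmx mulrAC -det_mulmx -map_mxM mulmxV // map_mx1 det1 mul1r //.
Qed.

End Spectrum.

(** * Weingarten equation and transformation laws *)

Section Weingarten.
Context {R : realType} {n : nat}.
Variables (V : set 'rV[R]_n) (W : set 'rV[R]_n.+1).
Variables (H : 'rV[R]_n.+1 -> 'M[R]_n.+1) (F : 'rV[R]_n -> 'rV[R]_n.+1).
Variables (v : 'rV[R]_n -> 'rV[R]_n.+1).
Hypotheses (oV : open V) (mH : metric_on W H) (sF : smooth_on V F).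
Hypotheses (sv : smooth_on V v) (FW : forall x, V x -> W (F x)).
Hypothesis Ev : forall x, V x -> frame F x *m H (F x) *m (v x)^T = 0.

(** Obtained by differentiating the orthogonality of the frame and the normal. *)
Lemma weingarten x i k : V x ->
  (nabla H F i v x *m H (F x) *m (frame F x)^T) 0 k = - second_form H F v x i k.
Proof.
move=> Vx; have HT := metric_on_tr mH (FW Vx).
have dE := smooth_mx_mdiff (smooth_frame sF) Vx.
have dv := mdiff_normal sv Vx.
have := nabla_compat mH sF FW Vx i dE dv.
rewrite (@near_eq_mpd _ _ _ _ _ _ (fun=> 0)); last first.
  by apply: filterS (V_nbhs oV Vx) => y; exact: Ev.
have -> : mpd i (fun=> 0) x = 0 :> 'M[R]_(n, 1).
  apply/matrixP => r s; rewrite [LHS]mxE [RHS]mxE.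
  by rewrite (@eq_pd _ _ _ (fun=> 0)) ?pd_cst // => y; rewrite mxE.
have -> : second_form H F v x i k = (nabla H F i (frame F) x *m H (F x) *m (v x)^T) k 0.
  by rewrite mxE.
have -> : (nabla H F i v x *m H (F x) *m (frame F x)^T) 0 k =
   (frame F x *m H (F x) *m (nabla H F i v x)^T) k 0.
  rewrite [RHS](_ : _ = ((frame F x *m H (F x) *m (nabla H F i v x)^T)^T) 0 k).
    by rewrite !trmx_mul trmxK HT mulmxA.
  by rewrite [RHS]mxE.
move/(congr1 (fun A : 'M[R]_(n, 1) => A k 0)); rewrite [LHS]mxE [RHS]addmxE.
by move/eqP; rewrite eq_sym addrC addr_eq0 => /eqP.
Qed.
End Weingarten.

Lemma frame_comp {R : realType} {q r l : nat} (V : set 'rV[R]_q) (W : set 'rV[R]_r)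
   (phi : 'rV[R]_q -> 'rV[R]_r) (A : 'rV[R]_r -> 'rV[R]_l) (B : 'rV[R]_q -> 'rV[R]_l) x :
  smooth_on V phi -> smooth_on W A -> V x -> W (phi x) ->
  (\near x, B x = A (phi x)) -> frame B x = frame phi x *m frame A (phi x).
Proof.
move=> sphi sA Vx Wx nA.
apply/matrixP => j k; rewrite [LHS]mxE [RHS]mxE.
rewrite (@near_eq_pd _ _ _ (fun y => A (phi y) 0 k)); last first.
  by apply: filterS nA => y ->.
rewrite (pd_comp (f := fun z => A z 0 k)); first last.
- exact: smooth_differentiable (sA k) Wx.
- exact: (map_differentiable sphi Vx).
rewrite (jacobian_frame sphi Vx); apply: eq_bigr => t _.
by rewrite [frame A _ _ _]mxE.
Qed.

Section ChangeTarget.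
Context {R : realType} {m : nat}.
Variables (W W' : set 'rV[R]_m) (H H' : 'rV[R]_m -> 'M[R]_m) (psi : 'rV[R]_m -> 'rV[R]_m).
Hypotheses (mH : metric_on W H) (mH' : metric_on W' H') (spsi : smooth_on W psi).
Hypothesis psiW : forall y, W y -> W' (psi y).
Hypothesis iso : forall y, W y -> H y = frame psi y *m H' (psi y) *m (frame psi y)^T.

(** Isometries are affine. In codimension zero the tangential part is
    everything, so Koszul's formula determines the full derivative of the frame;
    for a change of coordinates this is the transformation law of the
    Christoffel symbols. *)
Lemma nabla_isometry s y : W y ->
  nabla H' psi s (frame psi) y = conn H s y *m frame psi y.
Proof.
move=> Wy; have oW : open W by case: mH.
have K := nabla_frame_tangential oW mH' spsi psiW Wy s mH Wy.
have {}K := K (filterS (fun z => @iso z) (V_nbhs oW Wy)).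
rewrite -(conn_metric mH Wy) (iso Wy) in K.
have uH : frame psi y *m H' (psi y) *m (frame psi y)^T \in unitmx.
  by rewrite -(iso Wy); exact: (metric_on_unit mH).
have uP : H' (psi y) *m (frame psi y)^T \in unitmx.
  by move: uH; rewrite -mulmxA unitmx_mul => /andP[].
apply: (row_free_inj (A := H' (psi y) *m (frame psi y)^T)).
  by rewrite row_free_unit.
by rewrite /= !mulmxA K !mulmxA.
Qed.

(** Target coordinates are immaterial to covariant differentiation along [F]:
    the Leibniz rule for [frame psi] leaves a sum of instances of
    [nabla_isometry]. *)
Lemma nabla_change_target q (V : set 'rV[R]_q) (F : 'rV[R]_q -> 'rV[R]_m)
    (v v' : 'rV[R]_q -> 'rV[R]_m) (F' : 'rV[R]_q -> 'rV[R]_m) i x :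
  open V -> smooth_on V F -> smooth_on V v -> (forall x, V x -> W (F x)) -> V x ->
  (\near x, F' x = psi (F x)) ->
  (\near x, v' x = v x *m frame psi (F x)) ->
  frame F' x = frame F x *m frame psi (F x) /\
  nabla H' F' i v' x = nabla H F i v x *m frame psi (F x).
Proof.
move=> oV sF sv FW Vx nF nv.
have Wx := FW _ Vx.
have frE := frame_comp sF spsi Vx Wx nF.
split=> //.
have dP : mdiff (frame psi) (F x) by exact: (smooth_mx_mdiff (smooth_frame spsi) Wx).
have dv : mdiff v x.
  by move=> r s; rewrite (ord1 r); exact: smooth_differentiable (sv s) Vx.
have oE : omega H' F' i x = \sum_s frame F x i s *: omega H' psi s (F x).
  rewrite /omega frE (nbhs_singleton nF) /=.
  under [RHS]eq_bigr do rewrite scaler_sumr.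
  rewrite exchange_big /=; apply: eq_bigr => r _.
  rewrite [(_ *m _) i r]mxE scaler_suml; apply: eq_bigr => s _.
  by rewrite scalerA.
rewrite /nabla oE (nbhs_singleton nv) (near_eq_mpd _ nv).
rewrite mpdM //; last exact: (mdiff_comp sF Vx).
rewrite (mpd_comp sF Vx) // -addrA -mulmxA -mulmxDr mulmxDl; congr (_ + _).
rewrite -mulmxA; congr (_ *m _); rewrite mulmx_sumr mulmx_suml -big_split /=.
apply: eq_bigr => s _; rewrite -scalemxAr -scalerDr -scalemxAl; congr (_ *: _).
exact: nabla_isometry.
Qed.
End ChangeTarget.

(** * Hypersurfaces in charts *)

Section Restriction.
Context {R : realType} {m : nat}.

Lemma smooth_funS (U V : set 'rV[R]_m) (f : 'rV[R]_m -> R) :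
  V `<=` U -> smooth_fun U f -> smooth_fun V f.
Proof.
move=> VU sf k; move: (sf k); elim: k f {sf} => [|k IH] f /=.
  by move=> cf x /VU; exact: cf.
by move=> [df pdf]; split=> [x /VU|i]; [exact: df|exact: IH].
Qed.

Lemma smooth_onS q (U V : set 'rV[R]_m) (F : 'rV[R]_m -> 'rV[R]_q) :
  V `<=` U -> smooth_on U F -> smooth_on V F.
Proof. by move=> VU sF j; exact: smooth_funS VU (sF j). Qed.

Lemma metric_onS (U V : set 'rV[R]_m) G :
  open V -> V `<=` U -> metric_on U G -> metric_on V G.
Proof.
move=> oV VU [_ s p sm]; split=> // [x /VU|x /VU|j k]; [exact: s|exact: p|].
exact: smooth_funS VU (sm j k).
Qed.
End Restriction.

Section Charts.
Context {R : realType} {m q : nat}.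
Variables (M : manifold R m) (N : manifold R q).

Definition chart_image (a : chart M) : set 'rV[R]_m := chart_map M a @` dom M a.

Lemma param_dom a x : chart_image a x -> dom M a (param M a x).
Proof. by move=> [p ap <-]; rewrite chart_mapK. Qed.

Lemma paramK a x : chart_image a x -> chart_map M a (param M a x) = x.
Proof. by move=> [p ap <-]; rewrite chart_mapK. Qed.

Lemma repr_domP (f : M -> N) a b x : repr_dom f a b x <->
  chart_image a x /\ dom N b (f (param M a x)).
Proof.
split=> [[p [ap bp] <-]|[ax bx]].
  by split; [exists p|rewrite chart_mapK].
by exists (param M a x); [split => //; exact: param_dom|exact: paramK].
Qed.

Lemma param_near a x : chart_image a x -> {for x, continuous (param M a)}.
Proof. by move=> [p ap <-]; exact: param_continuous. Qed.

Lemma open_repr_dom (f : M -> N) a b : continuous f -> open (repr_dom f a b).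
Proof.
move=> cf; rewrite openE => x /repr_domP[ax bx].
have n1 : nbhs x (chart_image a).
  by apply: open_nbhs_nbhs; split=> //; exact: chart_map_open.
have n2 : nbhs x (param M a @^-1` (f @^-1` dom N b)).
  apply: (param_near ax); apply: cf; apply: open_nbhs_nbhs; split=> //.
  exact: dom_open.
by apply: filterS (filterI n1 n2) => y [ay by']; apply/repr_domP.
Qed.

Lemma local_metric_on (g : riem_metric M) a :
  metric_on (chart_image a) (local_metric g a).
Proof.
split=> [|x ax|x ax v|j k].
- exact: chart_map_open.
- by apply: gram_sym; exact: param_dom.
- by apply: gram_pos; exact: param_dom.
- exact: gram_smooth.
Qed.

End Charts.

Section HypersurfaceInCharts.
Context {R : realType} {n : nat}.
Variables (c : R) (N : manifold R n.+1) (h : riem_metric N).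
Variables (M : manifold R n) (g : riem_metric M).
Variables (f : M -> N) (nu : M -> chart N -> 'rV[R]_n.+1).
Hypotheses (imm : immersion f) (ind : induced_metric g h f).
Hypothesis nor : unit_normal_field h f nu.

Let cf : continuous f. Proof. by case: imm => -[]. Qed.

Section InCharts.
Variables (a : chart M) (b : chart N).

Let V := repr_dom f a b.
Let W := chart_image b.
Let H := local_metric h b.
Let F := chart_repr f a b.
Let G := local_metric g a.
Let v x := nu (param M a x) b.

Lemma V_open : open V. Proof. exact: open_repr_dom. Qed.

Lemma metric_source : metric_on V G.
Proof.
apply: metric_onS (local_metric_on g a); first exact: V_open.
by move=> x /repr_domP[].
Qed.

Lemma metric_target : metric_on W H. Proof. exact: local_metric_on. Qed.

Lemma repr_smooth : smooth_on V F. Proof. by case: imm => -[_ s] _; exact: s. Qed.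

Lemma normal_smooth : smooth_on V v. Proof. by case: nor => _ s _ _; exact: s. Qed.

Lemma repr_target x : V x -> W (F x).
Proof. by move=> /repr_domP[_ bx]; exists (f (param M a x)). Qed.

Lemma local_metricK x : V x -> H (F x) = gram h (f (param M a x)) b.
Proof.
by move=> /repr_domP[_ bx]; rewrite /H /local_metric /F /chart_repr /= chart_mapK.
Qed.

Lemma differentialE x : V x -> differential f a b (param M a x) = frame F x.
Proof.
move=> Vx; rewrite /differential -/F.
have /repr_domP[ax _] := Vx.
by rewrite (paramK ax); exact: (jacobian_frame repr_smooth Vx).
Qed.

Lemma induced_frame x : V x -> G x = frame F x *m H (F x) *m (frame F x)^T.
Proof.
move=> Vx; have /repr_domP[ax bx] := Vx.
rewrite (local_metricK Vx) -(differentialE Vx); apply: ind => //.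
exact: param_dom.
Qed.

Lemma frame_normal x : V x -> frame F x *m H (F x) *m (v x)^T = 0.
Proof.
move=> Vx; have /repr_domP[ax bx] := Vx.
rewrite (local_metricK Vx) -(differentialE Vx); case: nor => _ _ o _.
by apply: o => //; exact: param_dom.
Qed.

Lemma normal_unit x : V x -> v x *m H (F x) *m (v x)^T = 1%:M.
Proof.
move=> Vx; have /repr_domP[ax bx] := Vx.
rewrite (local_metricK Vx) [LHS]mx11_scalar; congr (_%:M).
by case: nor => _ _ _ u; exact: u.
Qed.

Lemma normal_derivativeE x i : V x ->
  row i (normal_derivative h f nu a b (param M a x)) = nabla H F i v x.
Proof.
move=> Vx; have /repr_domP[ax bx] := Vx.
apply/rowP => k; rewrite [LHS]mxE [LHS]mxE (differentialE Vx) (paramK ax).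
rewrite [RHS]addmxE; congr (_ + _); first by rewrite [RHS]mxE.
rewrite [RHS]mxE exchange_big /=; apply: eq_bigr => s _.
rewrite summxE mulr_sumr; apply: eq_bigr => r _; rewrite scalemxE conn_mx.
by rewrite mulrC; congr (_ * _); exact: mulrC.
Qed.

Lemma shape_opE x : V x -> shape_op g h f nu a b (param M a x) =
  second_form H F v x *m invmx (G x).
Proof.
move=> Vx; rewrite /shape_op -mulNmx; congr (_ *m _).
apply/matrixP => i k; rewrite oppmxE; apply: oppr_inj; rewrite opprK.
rewrite -(weingarten V_open metric_target repr_smooth normal_smooth repr_target
   frame_normal i k Vx).
rewrite -(normal_derivativeE i Vx) (local_metricK Vx) -(differentialE Vx).
by rewrite -!row_mul [RHS]mxE.
Qed.

Lemma ricci_op_shape x : V x -> constant_sectional_curvature h c ->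
  let A := shape_op g h f nu a b (param M a x) in
  ricci_op G x = (c * (n%:R - 1))%:M + \tr A *: A - A *m A.
Proof.
move=> Vx HC A; rewrite /A (shape_opE Vx).
apply: (ricci_op_gauss metric_source metric_target repr_smooth
  repr_target induced_frame frame_normal normal_unit Vx). have /repr_domP[ax bx] := Vx.
apply: (constant_sectional_has_curvature metric_target (repr_target Vx)).
by move=> u w; exact: HC.
Qed.

Lemma char_poly_shape_split x : V x ->
  exists l : seq R, char_poly (shape_op g h f nu a b (param M a x)) =
    \prod_(z <- l) ('X - z%:P).
Proof.
move=> Vx; rewrite (shape_opE Vx); apply: char_poly_selfadjoint.
- exact: (second_form_tr _ metric_source metric_target repr_smooth repr_target Vx).
- exact: (metric_on_tr metric_source).
- by case: metric_source => _ _ p _; exact: p.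
Qed.

Lemma mdiff_shape x : V x -> mdiff (fun y => second_form H F v y *m invmx (G y)) x.
Proof.
move=> Vx; apply: mdiffM; last exact: (mdiff_invmetric metric_source).
move=> i k; rewrite (_ : (fun y => _) =
    fun y => (nabla H F i (frame F) y *m H (F y) *m (v y)^T) k 0).
  apply: mdiffM; last exact/mdiff_tr/(mdiff_normal normal_smooth).
  apply: mdiffM; last exact: (mdiff_metric_comp metric_target repr_smooth repr_target).
  apply: (mdiff_nabla metric_target repr_smooth repr_target) => //.
  exact: (smooth_frame repr_smooth).
by apply/funext => y; rewrite [LHS]mxE.
Qed.

(** The derivative of the normal depends on the source chart only through two
    Jacobians. *)
Lemma normal_derivative_mx p : dom M a p -> dom N b (f p) ->
  normal_derivative h f nu a b p = frame v (chart_map M a p) + differential f a b p *m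
    \matrix_(r, k) (\sum_s christoffel H k r s (chart_map N b (f p)) * nu p b 0 s).
Proof.
move=> ap bp; apply/matrixP => i k; rewrite [LHS]mxE addmxE; congr (_ + _).
  by rewrite [RHS]mxE.
rewrite [RHS]mxE; apply: eq_bigr => r _; rewrite [X in _ = _ * X]mxE mulr_sumr.
by apply: eq_bigr => s _; rewrite mulrAC mulrC mulrAC.
Qed.

End InCharts.

(** A change [psi] of target coordinates multiplies both the frame and the
    derivative of the normal by the Jacobian of [psi] on the right, which is
    compensated by the transformation of the ambient Gram matrix. *)
Lemma shape_op_target a b b' p : dom M a p -> dom N b (f p) -> dom N b' (f p) ->
  shape_op g h f nu a b' p = shape_op g h f nu a b p.
Proof.
move=> ap bp b'p; pose x := chart_map M a p.
pose psi := chart_repr (@id N) b b'.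
pose W := repr_dom (@id N) b b'.
pose V := repr_dom f a b `&` repr_dom f a b'.
have Vx : V x by split; exists p.
have oV : open V by apply: openI; exact: V_open.
have oW : open W by apply: open_repr_dom => y; exact: cvg_id.
have mH : metric_on W (local_metric h b).
  by apply: metric_onS (local_metric_on h b) => // y /repr_domP[].
have spsi : smooth_on W psi by exact: transition_smooth.
have psiW y : W y -> chart_image b' (psi y).
  by move=> /repr_domP[_ y']; exists (param N b y).
have iso y : W y -> local_metric h b y =
    frame psi y *m local_metric h b' (psi y) *m (frame psi y)^T.
  move=> Wy; have /repr_domP[yb yb'] := Wy.
  have := gram_change h (param_dom yb) yb'.
  rewrite /differential (paramK yb) -/psi (jacobian_frame spsi Wy) => E.
  rewrite {1}/local_metric E; congr (_ *m _ *m _).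
  by rewrite /local_metric /psi /chart_repr /= chart_mapK.
have sF : smooth_on V (chart_repr f a b).
  by apply: smooth_onS (repr_smooth a b) => y [].
have sv : smooth_on V (fun x => nu (param M a x) b).
  by apply: smooth_onS (normal_smooth a b) => y [].
have FW y : V y -> W (chart_repr f a b y).
  move=> [/repr_domP[ya yb] /repr_domP[_ yb']]; exists (f (param M a y)) => //.
have nF : \near x, chart_repr f a b' x = psi (chart_repr f a b x).
  apply: filterS (V_nbhs oV Vx) => y [/repr_domP[ya yb] _].
  by rewrite /psi /chart_repr /= chart_mapK.
have nv : \near x, nu (param M a x) b' =
    nu (param M a x) b *m frame psi (chart_repr f a b x).
  apply: filterS (V_nbhs oV Vx) => y Vy; have Wy := FW _ Vy.
  have [/repr_domP[ya yb] /repr_domP[_ yb']] := Vy.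
  have [tg _ _ _] := nor; rewrite (tg _ _ _ yb yb').
  by rewrite /differential -/psi (jacobian_frame spsi Wy).
have [frE nabE] : frame (chart_repr f a b') x =
     frame (chart_repr f a b) x *m frame psi (chart_repr f a b x) /\
   forall i, nabla (local_metric h b') (chart_repr f a b') i
       (fun x => nu (param M a x) b') x =
     nabla (local_metric h b) (chart_repr f a b) i (fun x => nu (param M a x) b) x
       *m frame psi (chart_repr f a b x).
  have K i := nabla_change_target mH (local_metric_on h b') spsi psiW iso i oV sF sv
    FW Vx nF nv.
  by split=> [|i]; [exact: (frame_comp sF spsi Vx (FW _ Vx) nF)|have [] := K i].
have [Vb Vb'] := Vx.
have px : param M a x = p by rewrite chart_mapK.
have ND : normal_derivative h f nu a b' p =
    normal_derivative h f nu a b p *m frame psi (chart_repr f a b x).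
  apply/row_matrixP => i; rewrite row_mul -px !normal_derivativeE //.
have DF : differential f a b' p = differential f a b p *m frame psi (chart_repr f a b x).
  by rewrite -px !differentialE.
have HE : gram h (f p) b = frame psi (chart_repr f a b x) *m gram h (f p) b'
     *m (frame psi (chart_repr f a b x))^T.
  rewrite -px -(local_metricK Vb) -(local_metricK Vb') (iso _ (FW _ Vx)).
  by rewrite (nbhs_singleton nF).
by rewrite /shape_op ND DF HE trmx_mul !mulmxA.
Qed.

(** A change of source coordinates conjugates the shape operator by its
    Jacobian [T]. *)
Lemma shape_op_source a a' b p : dom M a p -> dom M a' p -> dom N b (f p) ->
  char_poly (shape_op g h f nu a' b p) = char_poly (shape_op g h f nu a b p).
Proof.
move=> ap a'p bp; pose x := chart_map M a' p.
pose phi := chart_repr (@id M) a' a.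
pose V := repr_dom (@id M) a' a `&` repr_dom f a' b.
have Vx : V x by split; exists p.
have oV : open V.
  by apply: openI; [apply: open_repr_dom => y; exact: cvg_id|exact: V_open].
have sphi : smooth_on V phi.
  by apply: smooth_onS (transition_smooth a' a) => y [].
have phix : phi x = chart_map M a p by rewrite /phi /chart_repr /= chart_mapK.
have Vphi : repr_dom f a b (phi x) by rewrite phix; exists p.
pose T := differential (@id M) a' a p.
have TE : T = frame phi x by rewrite /T /differential -/phi (jacobian_frame sphi Vx).
have param_phi : \near x, param M a' x = param M a (phi x).
  apply: filterS (V_nbhs oV Vx) => y [/repr_domP[ya' ya] _].
  by rewrite /phi /chart_repr /= chart_mapK.
have frF : frame (chart_repr f a' b) x = T *m frame (chart_repr f a b) (phi x).
  rewrite TE; apply: (frame_comp sphi (repr_smooth a b) Vx Vphi).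
  by apply: filterS param_phi => y E; rewrite /chart_repr /= E.
have frv : frame (fun x => nu (param M a' x) b) x =
    T *m frame (fun x => nu (param M a x) b) (phi x).
  rewrite TE; apply: (frame_comp sphi (normal_smooth a b) Vx Vphi).
  by apply: filterS param_phi => y E; rewrite /= E.
have pa : param M a (phi x) = p by rewrite phix chart_mapK.
have pa' : param M a' x = p by rewrite chart_mapK.
have DF : differential f a' b p = T *m differential f a b p.
  by rewrite -{1}pa' -pa !differentialE //; case: Vx.
have ND : normal_derivative h f nu a' b p = T *m normal_derivative h f nu a b p.
  rewrite !normal_derivative_mx // -/x frv -phix DF mulmxDr.
  by rewrite mulmxA.
have GE : gram g p a' = T *m gram g p a *m T^T by exact: gram_change.
have uG' : gram g p a' \in unitmx by apply: posdef_unit; exact: gram_pos.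
have uG : gram g p a \in unitmx by apply: posdef_unit; exact: gram_pos.
have uT : T \in unitmx.
  by move: uG'; rewrite GE -mulmxA unitmx_mul => /andP[].
suff -> : shape_op g h f nu a' b p = T *m shape_op g h f nu a b p *m invmx T.
  exact: char_poly_conj.
apply: (row_free_inj (A := gram g p a')); first by rewrite row_free_unit.
rewrite /= {2}GE !mulmxA mulmxKV // /shape_op !(mulNmx, mulmxN).
rewrite mulmxKV // !mulmxA mulmxKV // ND DF trmx_mul !mulmxA //.
Qed.

Lemma char_poly_shape_charts a a' b b' p :
  dom M a p -> dom M a' p -> dom N b (f p) -> dom N b' (f p) ->
  char_poly (shape_op g h f nu a' b' p) = char_poly (shape_op g h f nu a b p).
Proof.
by move=> ap a'p bp b'p; rewrite (shape_op_target a'p bp b'p) (shape_op_source ap a'p bp).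
Qed.
End HypersurfaceInCharts.

(** * Constancy of the spectrum on a connected hypersurface *)

Lemma locally_constant_connected (T : topologicalType) (S : Type) (phi : T -> S) :
  connected [set: T] -> (forall p, \forall q \near p, phi q = phi p) ->
  forall p q, phi q = phi p.
Proof.
move=> cT lc p q; pose B : set T := [set q | phi q = phi p].
have oB : open B.
  by rewrite openE => r Br; apply: filterS (lc r) => s E; rewrite /B /= E.
have cB : closed B.
  rewrite -openC openE => r nBr; apply: filterS (lc r) => s E Bs.
  by apply: nBr; rewrite /B /= -E.
have BT : B = [set: T].
  apply: cT; first by exists p.
    by exists B => //; rewrite setTI.
  by exists B => //; rewrite setTI.
have : B q by rewrite BT.
by [].
Qed.

Lemma horner_char_poly (F : comNzRingType) n (A : 'M[F]_n) t :
  (char_poly A).[t] = \det (t%:M - A).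
Proof.
rewrite /char_poly -horner_evalE -det_map_mx; congr (\det _).
apply/matrixP => i j; rewrite !mxE /= /horner_eval.
by rewrite !hornerE; case: (i == j); rewrite ?mulr1n ?mulr0n ?hornerE.
Qed.

Lemma poly_separated (F : numFieldType) (p q : {poly F}) : p <> q ->
  exists t, p.[t] <> q.[t].
Proof.
move=> pq; apply: contrapT => /forallNP E; apply: pq; apply/eqP.
rewrite -subr_eq0; apply/negPn/negP => nz.
pose rs : seq F := [seq i%:R | i <- iota 0 (size (p - q))].
have r1 : all (root (p - q)) rs.
  apply/allP => t _; rewrite rootE hornerD hornerN subr_eq0; apply/eqP.
  by apply: contrapT; exact: E.
have r2 : uniq rs.
  by rewrite map_inj_uniq ?iota_uniq // => i j /eqP; rewrite eqr_nat => /eqP.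
by have := max_poly_roots nz r1 r2; rewrite size_map size_iota ltnn.
Qed.

Lemma near_all_seq (T : topologicalType) (S : eqType) (x : T) (l : seq S)
    (Q : S -> T -> Prop) :
  (forall z, z \in l -> nbhs x (Q z)) ->
  nbhs x [set y | forall z, z \in l -> Q z y].
Proof.
elim: l => [|z l IH] Ql; first by apply: filterS filterT.
have h1 := Ql z (mem_head _ _).
have h2 := IH (fun w wl => Ql w (mem_behead (s := z :: l) wl)).
apply: filterS (filterI h1 h2) => y [Qz Qy] w.
by rewrite inE => /orP[/eqP -> //|]; exact: Qy.
Qed.

Section Main.
Context {R : realType} {n : nat}.
Variables (c : R) (N : manifold R n.+1) (h : riem_metric N).
Variables (M : manifold R n) (g : riem_metric M).
Variables (f : M -> N) (nu : M -> chart N -> 'rV[R]_n.+1).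
Hypotheses (imm : immersion f) (ind : induced_metric g h f).
Hypothesis nor : unit_normal_field h f nu.
Hypothesis n_gt0 : (0 < n)%N.

Let A a b p := shape_op g h f nu a b p.

Lemma isoparametric_mean_curvature :
  isoparametric g h f nu -> constant_mean_curvature g h f nu.
Proof.
move=> [s Hs]; exists (n%:R^-1 * - (\prod_(x <- s) ('X - x%:P))`_n.-1) => p a b ap bp.
by rewrite /mean_curvature -(Hs p a b ap bp) char_poly_trace // opprK.
Qed.

Lemma charts_at p : exists ab : chart M * chart N, dom M ab.1 p /\ dom N ab.2 (f p).
Proof.
have [a ap] := dom_cover p; have [b bp] := dom_cover (f p).
by exists (a, b).
Qed.

(** Evaluated at a point [t] separating two polynomials of the list [Ps], the
    characteristic polynomial of the shape operator is a determinant depending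
    continuously on the point of [M]; so nearby points avoid every member of
    [Ps] other than the one taken at [p]. *)
Lemma char_poly_shape_locally_constant (Ps : seq {poly R}) :
  (forall p a b, dom M a p -> dom N b (f p) -> char_poly (A a b p) \in Ps) ->
  forall p a b, dom M a p -> dom N b (f p) ->
  \forall q \near p, [/\ dom M a q, dom N b (f q) &
    char_poly (A a b q) = char_poly (A a b p)].
Proof.
move=> HPs p a b ap bp; pose x := chart_map M a p.
have Vx : repr_dom f a b x by exists p.
have px : param M a x = p by rewrite chart_mapK.
have oV : open (repr_dom f a b) by exact: (V_open imm).
pose B y := second_form (local_metric h b) (chart_repr f a b)
  (fun z => nu (param M a z) b) y *m invmx (local_metric g a y).
have BE y : repr_dom f a b y -> A a b (param M a y) = B y.
  by move=> Vy; rewrite /A (shape_opE g imm nor Vy).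
have near_x : nbhs x [set y | forall P, P \in Ps ->
    P <> char_poly (B x) -> char_poly (B y) <> P].
  apply: near_all_seq => P _; have [->|/eqP PB] := eqVneq P (char_poly (B x)).
    by apply: filterS filterT => y _ /(_ erefl).
  have [t] := poly_separated PB; rewrite [in X in _ <> X]horner_char_poly => Pt.
  pose D y := \det (t%:M - B y).
  have dD : differentiable D x.
    apply: differentiable_det; apply: mdiffD; first exact: mdiff_cst.
    by apply: mdiffN; exact: (mdiff_shape g imm nor Vx).
  have e0 : 0 < `|D x - P.[t]|.
    by rewrite normr_gt0 subr_eq0; apply/eqP => E; apply: Pt.
  apply: filterS (continuous_dist_lt e0 (differentiable_continuous dD)) => y Dy _ yP.
  by move: Dy; rewrite -yP horner_char_poly -/(D y) ltxx.
have nq : nbhs p (chart_map M a @^-1` (repr_dom f a b `&` [set y | forall P, P \in Ps ->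
    P <> char_poly (B x) -> char_poly (B y) <> P])).
  apply: (chart_map_continuous ap); apply: filterI near_x.
  by apply: open_nbhs_nbhs; split.
have na : nbhs p (dom M a) by apply: open_nbhs_nbhs; split=> //; exact: dom_open.
have cf : continuous f by case: imm => -[].
have nb : nbhs p (f @^-1` dom N b).
  by apply: cf; apply: open_nbhs_nbhs; split=> //; exact: dom_open.
apply: filterS (filterI nq (filterI na nb)) => q [[Vq Hq] [aq bq]]; split=> //.
have := HPs q a b aq bq.
have qE : param M a (chart_map M a q) = q by rewrite chart_mapK.
have -> : A a b q = B (chart_map M a q) by rewrite -BE // qE.
have -> : A a b p = B x by rewrite -BE // px.
by move=> inP; apply: contrapT => /(Hq _ inP); exact.
Qed.

Lemma mean_curvature_isoparametric :
  constant_sectional_curvature h c -> connected [set: M] ->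
  constant_ricci_eigenvalues g -> constant_mean_curvature g h f nu ->
  isoparametric g h f nu.
Proof.
move=> HC cM [s Hs] [H0 HH0].
pose Ps := split_polys n (quadratic_roots (c * (n%:R - 1)) (n%:R * H0) s).
have split_shape p a b : dom M a p -> dom N b (f p) ->
    exists l : seq R, char_poly (A a b p) = \prod_(z <- l) ('X - z%:P).
  move=> ap bp; have Vx : repr_dom f a b (chart_map M a p) by exists p.
  have [l] := char_poly_shape_split g imm nor Vx.
  by rewrite chart_mapK //; exists l.
have HPs p a b : dom M a p -> dom N b (f p) -> char_poly (A a b p) \in Ps.
  move=> ap bp; have Vx : repr_dom f a b (chart_map M a p) by exists p.
  have [l Hl] := split_shape p a b ap bp; apply: (char_poly_finite Hl).
  have trA : \tr (A a b p) = n%:R * H0.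
    rewrite -(HH0 p a b ap bp) /mean_curvature mulVKf //.
    by rewrite pnatr_eq0 -lt0n.
  have := ricci_op_shape imm ind nor Vx HC.
  by cbv zeta; rewrite (chart_mapK ap) -/(A a b p) trA => <-; exact: Hs.
have [ch chP] := choice charts_at.
pose phi p := char_poly (A (ch p).1 (ch p).2 p).
have phiE p a b : dom M a p -> dom N b (f p) -> char_poly (A a b p) = phi p.
  move=> ap bp; have [ap' bp'] := chP p.
  exact: (char_poly_shape_charts g imm nor ap' ap bp' bp).
have lc p : \forall q \near p, phi q = phi p.
  have [ap bp] := chP p.
  apply: filterS (char_poly_shape_locally_constant HPs ap bp) => q [aq bq].
  by rewrite !phiE.
have [[p0 _]|E] := pselect ([set: M] !=set0).
  have [ap bp] := chP p0; have [l Hl] := split_shape p0 _ _ ap bp.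
  exists l => p a b aq bq.
  rewrite /eigenvalues -/(A a b p) phiE // -Hl.
  exact: (locally_constant_connected cM lc).
by exists [::] => p; case: E; exists p.
Qed.

End Main.

Theorem theorem1p7 (R : realType) (n : nat) (c : R)
    (N : manifold R n.+1) (h : riem_metric N)
    (M : manifold R n) (g : riem_metric M)
    (f : M -> N) (nu : M -> chart N -> 'rV[R]_n.+1) :
  (3 <= n)%N ->
  simply_connected_space_form h c ->
  connected [set: M] ->
  immersion f ->
  induced_metric g h f ->
  unit_normal_field h f nu ->
  constant_ricci_eigenvalues g ->
  isoparametric g h f nu <-> constant_mean_curvature g h f nu.
Proof.
move=> n3 [_ _ HC] cM imm ind nor ricc.
have n0 : (0 < n)%N by exact: leq_trans n3.
split; first exact: isoparametric_mean_curvature.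
exact: mean_curvature_isoparametric HC cM ricc.
Qed.
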